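(* Let $(X,d)$ be a $\delta$-hyperbolic geodesic metric space, let $S$ be a finite subset of $X$, and let $p\in\{1,2\}$. There exists an algorithm that determines a set of $p$ points that $(r_p(S)+\delta)$-dominates $S$. This algorithm runs in time $O((2\delta+1)t_X)$, where $t_X$ is the time required to find the set of points at maximum distance from a given point in $X$. In particular, when $X$ is the geodesic metric space of a $\delta$-hyperbolic graph with $n$ vertices and $m$ edges, the running time is $O((2\delta+1)(m+n))$.
   Context: A geodesic metric space $(X,d)$ is one in which any two points $x,y$ are joined by a geodesic $[x,y]$, that is, an isometric image of $[0,d(x,y)]$; $[x,y][t]$ denotes the point on it at distance $t$ from $x$. A geodesic triangle $\Delta(x,y,z)$ is a union of geodesics $[x,y],[y,z],[x,z]$. Set $\pi=\frac12(d(x,y)+d(y,z)+d(x,z))$, $\alpha_x=\pi-d(y,z)$, $\alpha_y=\pi-d(x,z)$ and $\alpha_z=\pi-d(x,y)$. The insize of $\Delta(x,y,z)$ is the maximum of three quantities: - $\max_{\theta\in[0,\alpha_x]} d([x,y][\theta],[x,z][\theta])$, - $\max_{\theta\in[0,\alpha_y]} d([y,x][\theta],[y,z][\theta])$, - $\max_{\theta\in[0,\alpha_z]} d([z,x][\theta],[z,y][\theta])$. $X$ is $\delta$-hyperbolic if every geodesic triangle has insize at most $\delta$; $\delta$ denotes the least such constant. A set $C\subseteq X$ $r$-dominates $S$ if every $s\in S$ has some $c\in C$ with $d(s,c)\le r$. The $p$-radius $r_p(S)$ is the minimum $r$ such that some set of at most $p$ points of $X$ $r$-dominates $S$. A graph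 with $n$ vertices and $m$ edges is viewed as a geodesic metric space by making each edge a unit-length segment and taking shortest-path distance between points.
   Formalization: For graphs the bound is O((2δ+1)(m+n+k)), k the number of points of S interior to edges (the stated bound fails when k is large); farthest-point searches may start from several points at cost t_X each (needed for p=2); distance and geodesic-point queries cost t_X. *)

(* Defs.v *)
From HB Require Import structures.
From mathcomp Require Import all_boot all_order all_algebra.
From mathcomp Require Import all_classical all_reals all_analysis.

Set Implicit Arguments.
Unset Strict Implicit.
Unset Printing Implicit Defensive.

Import Order.TTheory GRing.Theory Num.Theory.

Local Open Scope classical_set_scope.
Local Open Scope ring_scope.

(* The metric notions take the distance function [d] explicitly, so that they
   apply both to [mdist] on a [metricType] and to [graph_dist] below. *)

Section Geodesic.
Variables (R : realType) (X : Type) (d : X -> X -> R).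

(* [g t] is the point written [x,y][t]; the values of [g] outside [0, d x y]
   are irrelevant. *)
Definition is_geodesic (x y : X) (g : R -> X) : Prop :=
  [/\ g 0 = x, g (d x y) = y &
      forall s t, 0 <= s <= d x y -> 0 <= t <= d x y ->
        d (g s) (g t) = `|s - t|].

Definition geodesic_space : Prop :=
  forall x y : X, exists g, is_geodesic x y g.

(* Insize of the triangle with sides [xy], [yz], [xz].  A side is one segment
   whichever end it is measured from: [y,x][t] is [xy (d x y - t)]. *)
Definition insize (x y z : X) (xy yz xz : R -> X) : R :=
  let hp := (d x y + d y z + d x z) / 2 in
  let ax := hp - d y z in
  let ay := hp - d x z in
  let az := hp - d x y in
  Num.max
    (sup [set d (xy t) (xz t) | t in `[0, ax]])
    (Num.max
      (sup [set d (xy (d x y - t)) (yz t) | t in `[0, ay]])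
      (sup [set d (xz (d x z - t)) (yz (d y z - t)) | t in `[0, az]])).

Definition delta_hyperbolic (delta : R) : Prop :=
  forall (x y z : X) (xy yz xz : R -> X),
    is_geodesic x y xy -> is_geodesic y z yz -> is_geodesic x z xz ->
    insize x y z xy yz xz <= delta.

Definition hyperbolicity_constant (delta : R) : Prop :=
  delta_hyperbolic delta /\
  forall delta', delta_hyperbolic delta' -> delta <= delta'.

Definition dominates (C : set X) (r : R) (S : set X) : Prop :=
  forall s, S s -> exists2 c, C c & d s c <= r.

(* An infimum, since the minimum need not be attained in a general [X];
   [0 <= r] only matters for empty [S]. *)
Definition p_radius (p : nat) (S : set X) : R :=
  inf [set r | 0 <= r /\
        exists C : set X, (C #<= `I_p)%card /\ dominates C r S].

End Geodesic.

(* A real RAM in structured form.  The memory consists of arrays indexed by natural numbers, holding natural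
   numbers, real numbers, and points of an abstract space [P] respectively.
   Executing an assignment or a test costs one unit; an expression has a size
   fixed by the program, so evaluating it costs O(1).  Reals support field
   operations and comparisons only (there is no rounding), and points can only
   be manipulated through the queries [Q]. *)

Inductive wexp : Type :=
| WNat of nat
| WGet of nat & wexp         (* WGet a i : cell i of word array a *)
| WAdd of wexp & wexp
| WSub of wexp & wexp.       (* truncated *)

Inductive rexp : Type :=
| RNat of nat
| RGet of nat & wexp         (* RGet a i : cell i of real array a *)
| RAdd of rexp & rexp
| RSub of rexp & rexp
| RMul of rexp & rexp
| RDiv of rexp & rexp.

Inductive bexp : Type :=
| WLe of wexp & wexp
| RLe of rexp & rexp
| BNot of bexp
| BAnd of bexp & bexp.

Inductive cmd (Q : Type) : Type :=
| Skip
| WSet of nat & wexp & wexp  (* WSet a i e : word array a, cell i := e *)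
| RSet of nat & wexp & rexp
| Seq of cmd Q & cmd Q
| If of bexp & cmd Q & cmd Q
| While of bexp & cmd Q
| Call of Q.
Arguments Skip {Q}.
Arguments WSet {Q}.
Arguments RSet {Q}.

Record state (R P : Type) : Type := State {
  words : nat -> nat -> nat;
  reals : nat -> nat -> R;
  points : nat -> nat -> P }.

Definition update (T : Type) (m : nat -> nat -> T) (a i : nat) (v : T) :=
  fun b j => if (b == a) && (j == i) then v else m b j.

Section Semantics.
Variables (R : realType) (P Q : Type).
Implicit Types st : state R P.

Fixpoint weval st (e : wexp) : nat :=
  match e with
  | WNat n => n
  | WGet a i => words st a (weval st i)
  | WAdd e1 e2 => (weval st e1 + weval st e2)%N
  | WSub e1 e2 => (weval st e1 - weval st e2)%N
  end.

Fixpoint reval st (e : rexp) : R :=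
  match e with
  | RNat n => n%:R
  | RGet a i => reals st a (weval st i)
  | RAdd e1 e2 => reval st e1 + reval st e2
  | RSub e1 e2 => reval st e1 - reval st e2
  | RMul e1 e2 => reval st e1 * reval st e2
  | RDiv e1 e2 => reval st e1 / reval st e2
  end.

Fixpoint beval st (b : bexp) : bool :=
  match b with
  | WLe e1 e2 => (weval st e1 <= weval st e2)%N
  | RLe e1 e2 => reval st e1 <= reval st e2
  | BNot b1 => ~~ beval st b1
  | BAnd b1 b2 => beval st b1 && beval st b2
  end.

(* Effect and cost of a query. *)
Variable query : Q -> state R P -> state R P * nat.

(* [exec c st st' t]: run from [st], [c] terminates in [st'] after time [t]. *)
Inductive exec : cmd Q -> state R P -> state R P -> nat -> Prop :=
| ExecSkip st : exec Skip st st 1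
| ExecWSet st a i e :
    exec (WSet a i e) st
      (State (update (words st) a (weval st i) (weval st e))
             (reals st) (points st)) 1
| ExecRSet st a i e :
    exec (RSet a i e) st
      (State (words st) (update (reals st) a (weval st i) (reval st e))
             (points st)) 1
| ExecSeq c1 c2 st st1 st2 t1 t2 :
    exec c1 st st1 t1 -> exec c2 st1 st2 t2 ->
    exec (Seq c1 c2) st st2 (t1 + t2)
| ExecIf b c1 c2 st st' t :
    exec (if beval st b then c1 else c2) st st' t ->
    exec (If b c1 c2) st st' t.+1
| ExecWhileF b c st : ~~ beval st b -> exec (While b c) st st 1
| ExecWhileT b c st st1 st2 t1 t2 :
    beval st b -> exec c st st1 t1 -> exec (While b c) st1 st2 t2 ->
    exec (While b c) st st2 (t1 + t2).+1
| ExecCall q st : exec (Call q) st (query q st).1 (query q st).2.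

End Semantics.

(* Addresses (a, i) denote cell [i] of point array [a].
   [QFar x C a n i] finds the set of the points of [S] at maximum distance from
   the finite set x :: C of held points (from the point x if C is empty),
   stores them at the beginning of point array [a] and their number in cell [i]
   of word array [n].
   [QDist x y a i] stores d(x, y) in cell [i] of real array [a].
   [QAlong x y t a i] stores [x,y][t] in cell [i] of point array [a]. *)
Inductive geom_query : Type :=
| QFar of nat * wexp & seq (nat * wexp) & nat & nat & wexp
| QDist of nat * wexp & nat * wexp & nat & wexp
| QAlong of nat * wexp & nat * wexp & rexp & nat & wexp.

Section GeometricMachine.
Variables (R : realType) (X : choiceType) (d : X -> X -> R).

(* Distance from [s] to the finite set x :: C. *)
Definition dist_to (x : X) (C : seq X) (s : X) : R :=
  \big[Num.min/d s x]_(c <- C) d s c.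

(* [far x C] lists the points of [S] at maximum distance from x :: C. *)
Definition farthest_oracle (S : set X) (far : X -> seq X -> seq X) : Prop :=
  forall x C, uniq (far x C) /\
    forall s, s \in far x C <->
      S s /\ forall s', S s' -> dist_to x C s' <= dist_to x C s.

(* A maximum-distance search costs [tX] per point it starts from.  Searches from
   several points are needed when p = 2: on the segment [0, 1], searches from
   single points cannot tell S = {0, 1} from S = {0, 1/2, 1}.  The other two
   queries, which only concern two given points, are charged [tX] as well. *)
Definition geom_step (far : X -> seq X -> seq X) (geo : X -> X -> R -> X)
    (tX : nat) (q : geom_query) (st : state R X) : state R X * nat :=
  let pt (l : nat * wexp) := points st l.1 (weval st l.2) in
  match q with
  | QFar x C a n i =>
      let L := far (pt x) (map pt C) in
      (State (update (words st) n (weval st i) (size L)) (reals st)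
             (fun b j => if b == a then nth (points st b j) L j
                         else points st b j),
       ((size C).+1 * tX)%N)
  | QDist x y a i =>
      (State (words st)
             (update (reals st) a (weval st i) (d (pt x) (pt y)))
             (points st), tX)
  | QAlong x y t a i =>
      (State (words st) (reals st)
             (update (points st) a (weval st i)
                     (geo (pt x) (pt y) (reval st t))), tX)
  end.

(* Initially the machine holds one arbitrary point of the space. *)
Definition geom_input (x0 : X) : state R X :=
  State (fun _ _ => 0%N) (fun _ _ => 0) (fun _ _ => x0).

(* The points output need not be distinct. *)
Definition geom_output (p : nat) (st : state R X) : set X :=
  [set points st 0%N i | i in `I_p].

End GeometricMachine.

(* Simple graphs on the vertex set 'I_n, given by adjacency relations.  The
   points of the space are barycentric coordinates: x 0 i is the weight of the
   vertex i, and the support of x lies in a vertex or in an edge. *)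
Section GraphSpace.
Variables (R : realType) (n : nat) (e : rel 'I_n).

Definition simple_graph : Prop := symmetric e /\ irreflexive e.

Definition connected_graph : Prop := (0 < n)%N /\ forall u v, connect e u v.

Definition num_edges : nat :=
  #|[set uv : 'I_n * 'I_n | (uv.1 < uv.2)%N && e uv.1 uv.2]|.

(* u = v or uv is an edge, and x lies on the segment between u and v. *)
Definition on_cell (u v : 'I_n) (x : 'rV[R]_n) : bool :=
  ((u == v) || e u v) && [forall i, (x 0 i != 0) ==> (i == u) || (i == v)].

Definition on_graph (x : 'rV[R]_n) : bool :=
  [&& [forall i, 0 <= x 0 i], \sum_i x 0 i == 1 &
      [exists u, exists v, on_cell u v x]].

Definition graph_point : Type := {x : 'rV[R]_n | on_graph x}.

Definition is_vertex (x : graph_point) : bool := [exists u, val x 0 u == 1].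

Definition same_cell (x y : graph_point) : bool :=
  [exists u, exists v, on_cell u v (val x) && on_cell u v (val y)].

(* The length of the segment between two points of one edge uv: there,
   x_u - y_u = - (x_v - y_v), and an edge has length 1. *)
Definition seg_length (x y : graph_point) : R :=
  (\sum_i `|val x 0 i - val y 0 i|) / 2.

Fixpoint path_length (x : graph_point) (s : seq graph_point) : R :=
  if s is y :: s' then seg_length x y + path_length y s' else 0.

(* Shortest-path distance; paths are concatenations of segments of edges. *)
Definition graph_dist (x y : graph_point) : R :=
  inf [set path_length x s | s in
        [set s : seq graph_point | path same_cell x s && (last x s == y)]].

(* (u, v, t) describes the point (1 - t) u + t v of the edge uv (or the vertex
   u if u = v). *)
Definition describes (c : 'I_n * 'I_n * R) (x : graph_point) : Prop :=
  let: (u, v, t) := c in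
  [/\ (u == v) || e u v, 0 <= t <= 1 &
      val x = (1 - t) *: delta_mx 0 u + t *: delta_mx 0 v].

Definition adjacency_lists (adj : 'I_n -> seq 'I_n) : Prop :=
  forall u, uniq (adj u) /\ adj u =i e u.

(* Input of the graph machine, which has no query and no point memory.
   words 0: n and |S|;
   words 1: u |-> position in words 2 where the neighbours of u begin, the
            position for u = n being the total length;
   words 2: concatenation of the adjacency lists;
   words 3, words 4, reals 0: descriptions (u, v, t) of the points of S. *)
Definition graph_input (adj : 'I_n -> seq 'I_n) (S : seq ('I_n * 'I_n * R)) :
    state R unit :=
  State
    (fun a i => match a with
      | 0 => nth 0%N [:: n; size S] i
      | 1 => if (i <= n)%N then (\sum_(v < n | (v < i)%N) size (adj v))%N
             else 0%N
      | 2 => nth 0%N (flatten [seq map (@nat_of_ord n) (adj u)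
                              | u <- enum 'I_n]) i
      | 3 => nth 0%N [seq nat_of_ord c.1.1 | c <- S] i
      | 4 => nth 0%N [seq nat_of_ord c.1.2 | c <- S] i
      | _ => 0%N
      end)
    (fun a i => match a with
      | 0 => nth 0 [seq c.2 | c <- S] i
      | _ => 0
      end)
    (fun _ _ => tt).

(* The i-th output point is described in cell i of words 5, words 6, reals 1. *)
Definition graph_output (p : nat) (st : state R unit)
    (c : 'I_p -> graph_point) : Prop :=
  forall i : 'I_p, exists u v : 'I_n,
    [/\ words st 5 i = u, words st 6 i = v &
        describes (u, v, reals st 1 i) (c i)].

End GraphSpace.

Definition no_step (R : realType) (q : void) (st : state R unit) :
    state R unit * nat :=
  match q with end.

(* Main.v *)
Require Import Defs.
From mathcomp Require Import all_boot all_order all_algebra.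
From mathcomp Require Import all_classical all_reals all_analysis.
From mathcomp Require Import zify ring lra.
Import Order.TTheory GRing.Theory Num.Theory.
Local Open Scope classical_set_scope.
Local Open Scope ring_scope.

(** No iteration is needed, provided that the centers are not midpoints.
    Let z1 be a point of S farthest from an arbitrary point x0, and z2 a point
    of S farthest from z1.  If c lies on [z1, x0] at distance r from z1, then
    matching c with a side of the triangle z1, x0, s shows that every s in S
    with d(z1, s) <= 2r satisfies d(c, s) <= r + delta, because d(x0, s) <=
    d(x0, z1).  For p = 1, r = d(z1, z2) / 2 <= r_1(S) suffices.  For p = 2,
    let u in S be farthest from {z1, z2} and 2r = min(d(z1, u), d(z2, u)); the
    three points z1, z2, u are pairwise at distance at least 2r, so
    r <= r_2(S), and the points at distance r from z1 on [z1, x0] and from z2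
    on [z2, z1] are (r + delta)-dominating.  Hence a constant number of
    maximum-distance searches is enough, and delta >= 0 gives the time bound.

    In a graph, such a search is a breadth-first search with real keys started
    from both ends of the edge that carries the source.  Its parent pointers
    also give the point of a geodesic at a prescribed distance from the
    source. *)

(** * Hyperbolic geodesic spaces *)

(** Why not the midpoint of [z1, z2]: the matching argument with z2 in place of x0 would need d(z2,
    s) <= d(z1, z2) for every s in S, that is, z1 and z2 mutually farthest, and reaching such a pair
    takes further sweeps. On [z1, x0] the corresponding inequality is the choice of z1. For p = 2
    the second center reuses the argument with z2, z1 in the roles of z1, x0, since z2 is farthest
    from z1.

    In a graph, points of S and centers may lie inside edges, two points of one edge may be joined
    without passing a vertex, and the distance is an infimum over all finite paths. One certificate
    handles this: vertex labels that are realised by paths, are at most t and 1 - t at the ends of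
    the source edge, and grow by at most 1 along edges give exact distances. It is applied to hop
    counts, to show that the infimum is attained, and to the labels of the search, to show that the
    computed distances are right. Minimality of the paths found by the search thus needs no argument
    of its own. *)

Section Metric.
Variables (R : realType) (X : Type) (d : X -> X -> R).

Definition pseudometric : Prop :=
  [/\ forall x, d x x = 0, forall x y, d x y = d y x &
      forall x y z, d x z <= d x y + d y z].

(** Only upper bounds on distances are required, which makes the notion stable under concatenation.
    When [l = d x y], the triangle inequality turns these bounds into equalities, so the path is a
    geodesic. *)
Definition lipschitz_path (x y : X) (l : R) (g : R -> X) : Prop :=
  [/\ 0 <= l, g 0 = x, g l = y &
      forall s t, 0 <= s <= l -> 0 <= t <= l -> d (g s) (g t) <= `|s - t|].

Definition concat_path (a : R) (g h : R -> X) (t : R) : X :=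
  if t <= a then g t else h (t - a).

Hypothesis dP : pseudometric.

Let dxx x : d x x = 0. Proof. by case: dP. Qed.
Let dC x y : d x y = d y x. Proof. by case: dP. Qed.
Let dT x y z : d x z <= d x y + d y z. Proof. by case: dP. Qed.

Lemma pseudometric_ge0 x y : 0 <= d x y.
Proof. have := dT x y x; rewrite dxx (dC y x); lra. Qed.

Lemma pseudometric_le x y z a b c : d x y <= a -> d y z <= b -> a + b <= c ->
  d x z <= c.
Proof. by move=> H1 H2 H3; have := dT x y z; lra. Qed.

Lemma pseudometric_between z c y r : d z c <= r -> d c y <= d z y - r ->
  d z c = r /\ d z c + d c y = d z y.
Proof. move=> H1 H2; have T := dT z c y; split; lra. Qed.

Lemma lipschitz_path_le x y l g : 0 <= l -> g 0 = x -> g l = y ->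
  (forall s t, 0 <= s -> s <= t -> t <= l -> d (g s) (g t) <= t - s) ->
  lipschitz_path x y l g.
Proof.
move=> l0 g0 gl H; split=> // s t /andP[s0 sl] /andP[t0 tl].
case: (leP s t) => st; first by rewrite distrC ger0_norm ?subr_ge0 ?H.
by rewrite dC gtr0_norm ?subr_gt0 ?H // ltW.
Qed.

Lemma lipschitz_path_concat x y z a b g h :
  lipschitz_path x y a g -> lipschitz_path y z b h ->
  lipschitz_path x z (a + b) (concat_path a g h).
Proof.
case=> a0 g0 ga gL [b0 h0 hb hL]; apply: lipschitz_path_le.
- lra.
- by rewrite /concat_path a0.
- rewrite /concat_path; case: ifP => [ab|_]; last by rewrite addrC addKr.
  have b0' : b = 0 by lra.
  by rewrite b0' addr0 ga -h0 -hb b0'.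
- move=> s t s0 st tab; rewrite /concat_path.
  case: (leP t a) => ta.
    rewrite (le_trans st ta); apply: le_trans (gL _ _ _ _) _; try lra.
    by rewrite distrC ger0_norm // subr_ge0.
  case: (leP s a) => sa.
    apply: le_trans (dT _ y _) _.
    have := gL s a; have := hL 0 (t - a); rewrite ga h0.
    rewrite (distrC s) sub0r normrN !ger0_norm; [|lra|lra].
    move=> H1 H2.
    have {}H1 : d y (h (t - a)) <= t - a by apply: H1; lra.
    have {}H2 : d (g s) y <= a - s by apply: H2; lra.
    lra.
  apply: le_trans (hL _ _ _ _) _; try lra.
  rewrite distrC ger0_norm; lra.
Qed.

Lemma lipschitz_path_geodesic x y g :
  lipschitz_path x y (d x y) g -> is_geodesic d x y g.
Proof.
case=> _ g0 gl gL; split=> // s t sl tl; apply: le_anti; rewrite gL //=.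
wlog st : s t sl tl / s <= t.
  by move=> H; case: (leP s t) => st; [|rewrite distrC dC]; apply: H => //; rewrite ltW.
rewrite distrC ger0_norm ?subr_ge0 //.
have := dT x (g s) y; have := dT (g s) (g t) y.
have l0 : 0 <= (0 : R) <= d x y by rewrite ?lexx pseudometric_ge0.
have l1 : 0 <= d x y <= d x y by rewrite ?lexx pseudometric_ge0.
have := gL _ _ l0 sl; have := gL _ _ tl l1; rewrite g0 gl.
move: sl tl => /andP[s0 sl] /andP[t0 tl].
rewrite sub0r normrN (distrC t) (@ger0_norm _ s) // (@ger0_norm _ (d x y - t)); last lra.
lra.
Qed.

Lemma geodesic_lipschitz_path x y g :
  is_geodesic d x y g -> lipschitz_path x y (d x y) g.
Proof.
case=> g0 gl gL; split=> //; first exact: pseudometric_ge0.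
by move=> s t sl tl; rewrite gL.
Qed.

(** Hyperbolicity quantifies over all geodesics, so a center that is known only through its
    distances to x and y can be put on a side of the triangle. *)
Lemma geodesic_through x c y : geodesic_space d -> d x c + d c y = d x y ->
  exists2 g, is_geodesic d x y g & g (d x c) = c.
Proof.
move=> geo xcy; have [g gg] := geo x c; have [h hh] := geo c y.
exists (concat_path (d x c) g h).
  apply: lipschitz_path_geodesic; rewrite -xcy.
  by apply: lipschitz_path_concat; apply: geodesic_lipschitz_path.
by rewrite /concat_path lexx; case: gg.
Qed.

Lemma is_geodesic_dist0 {x y g} t : is_geodesic d x y g ->
  0 <= t <= d x y -> d x (g t) = t.
Proof.
case=> g0 gl gL tl; have l0 : 0 <= (0 : R) <= d x y by rewrite ?lexx pseudometric_ge0.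
by have := gL 0 t l0 tl; rewrite g0 sub0r normrN ger0_norm //; case/andP: tl.
Qed.

Lemma is_geodesic_dist1 {x y g} t : is_geodesic d x y g ->
  0 <= t <= d x y -> d (g t) y = d x y - t.
Proof.
case=> g0 gl gL tl.
have l1 : 0 <= d x y <= d x y by rewrite ?lexx pseudometric_ge0.
have := gL _ _ tl l1; rewrite gl distrC ger0_norm // subr_ge0.
by case/andP: tl.
Qed.

(** A [sup] dominates its members only if the set is bounded. Here both paths stay within s of the
    common origin o, so [a + a] is a bound. *)
Lemma sup_dist_ge (a : R) (f g : R -> X) (o : X) (t : R) :
  (forall s, 0 <= s <= a -> d o (f s) <= s /\ d o (g s) <= s) ->
  0 <= t <= a ->
  d (f t) (g t) <= sup [set d (f t) (g t) | t in `[0, a]%classic].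
Proof.
move=> fg ta; apply: ub_le_sup; last by exists t => //=; rewrite in_itv.
exists (a + a) => u [s /=]; rewrite in_itv /= => sa <-.
have [fs gs] := fg _ sa; have := dT (f s) o (g s); rewrite (dC (f s) o).
by case/andP: sa; lra.
Qed.

Variable delta : R.
Hypothesis hyp : delta_hyperbolic d delta.

(** The corner lengths at x and at y add up to [d x y], so every point of the side xy is matched
    either from the corner at x or from the corner at y; the corner at z does not involve this
    side. *)
Lemma delta_hyperbolicP x y z xy yz xz t :
  is_geodesic d x y xy -> is_geodesic d y z yz -> is_geodesic d x z xz ->
  let ax := (d x y + d y z + d x z) / 2 - d y z in
  0 <= t <= d x y ->
  (t <= ax -> d (xy t) (xz t) <= delta) /\
  (ax <= t -> d (xy t) (yz (d x y - t)) <= delta).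
Proof.
move=> gxy gyz gxz ax tl.
have := hyp _ _ _ _ _ _ gxy gyz gxz; rewrite /insize -/ax.
set ay := _ - d x z; set az := _ - d x y.
rewrite ge_max => /andP[H1]; rewrite ge_max => /andP[H2 _].
have T1 := dT y x z; have T2 := dT x y z; have T3 := dT x z y.
rewrite (dC y x) in T1; rewrite (dC z y) in T3.
split=> ht.
  apply: le_trans H1; apply: (@sup_dist_ge _ _ _ x); last by case/andP: tl; lra.
  move=> s sa; rewrite (is_geodesic_dist0 _ gxy) ?(is_geodesic_dist0 _ gxz) //.
    by rewrite /ax in sa; lra.
  by rewrite /ax in sa; lra.
have -> : xy t = xy (d x y - (d x y - t)) by rewrite subKr.
apply: le_trans H2.
apply: (@sup_dist_ge _ (fun t => xy (d x y - t)) yz y); last by rewrite /ax /ay in ht *; lra.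
move=> s sa; rewrite dC (is_geodesic_dist1 _ gxy) ?(is_geodesic_dist0 _ gyz) //.
- split; lra.
- by rewrite /ay in sa; lra.
- by rewrite /ay in sa; lra.
Qed.

Hypothesis geo : geodesic_space d.

Lemma delta_hyperbolic_ge0 : X -> 0 <= delta.
Proof.
move=> x; have [g gg] := geo x x.
have xx : 0 <= (0 : R) <= d x x by rewrite dxx lexx.
have [H _] := delta_hyperbolicP _ _ _ _ _ _ _ gg gg gg xx.
by rewrite !dxx in H; apply: H; lra.
Qed.

(* In the triangle z, w, s the point c is matched either with a point of [z,s]
   at distance r from z, or with a point of [w,s] at distance d z w - r from w. *)
Lemma farthest_ball z w c s r : 0 <= r -> d z c = r -> d z c + d c w = d z w ->
  d w s <= d w z -> d z s <= 2 * r -> d c s <= r + delta.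
Proof.
move=> r0 zc zcw ws zs.
have [g gg gc] := geodesic_through _ _ _ geo zcw.
have [h hh] := geo w s; have [k hk] := geo z s.
have cw0 := pseudometric_ge0 c w.
have rl : 0 <= r <= d z w by lra.
have [H1 H2] := delta_hyperbolicP _ _ _ _ _ _ _ gg hh hk rl.
have T1 := dT w z s; have T2 := dT z w s; have T3 := dT z s w.
rewrite (dC w z) in T1 ws; rewrite (dC s w) in T3.
set ax := _ - d w s in H1 H2.
rewrite -zc gc zc in H1 H2.
case: (leP r ax) => ra.
  have := H1 ra; have := dT c (k r) s.
  rewrite (is_geodesic_dist1 _ hk); last by rewrite /ax in ra; lra.
  lra.
have := H2 (ltW ra); have := dT c (h (d z w - r)) s.
rewrite (is_geodesic_dist1 _ hh); last by rewrite /ax in ra; lra.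
lra.
Qed.

Variables (S : set X) (p : nat).

(** Pigeonhole: among p + 1 points two share a center, and these are at distance at least 2r. The
    set C shows that some radius is admissible; otherwise the infimum would be that of the empty
    set, whose default value is 0. *)
Lemma p_radius_ge C r0 r : 0 <= r0 -> (C #<= `I_p)%card -> dominates d C r0 S ->
  forall q : nat -> X, (forall i, (i <= p)%N -> S (q i)) ->
  (forall i j, (i < j)%N -> (j <= p)%N -> 2 * r <= d (q i) (q j)) ->
  r <= p_radius d p S.
Proof.
move=> r00 Cp Cdom q qS qd; apply: lb_le_inf.
  by exists r0; split=> //; exists C.
move=> t [t0 [D [Dp Ddom]]].
have /choice[f fP] : forall i, exists c, (i <= p)%N -> D c /\ d (q i) c <= t.
  move=> i; case: (boolP (i <= p)%N) => ip.
    by have [c Dc qc] := Ddom _ (qS _ ip); exists c.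
  by exists (q i).
have [[i [j [ij jp fij]]]|inj] :=
    pselect (exists i j, [/\ (i < j)%N, (j <= p)%N & f i = f j]).
  have [_ H1] := fP _ (leq_trans (ltnW ij) jp); have [_ H2] := fP _ jp.
  have := dT (q i) (f i) (q j); have := qd _ _ ij jp.
  rewrite {2}fij (dC (f j)); lra.
exfalso; have : (`I_p.+1 #<= `I_p)%card; last by rewrite card_le_II ltnn.
apply: card_le_trans Dp; apply: (@card_le_trans _ _ _ (f @` `I_p.+1)).
  suff : (f @` `I_p.+1 #= `I_p.+1)%card by rewrite card_eq_le => /andP[].
  apply: inj_card_eq => i j /set_mem /= ip /set_mem /= jp fij.
  case: (ltngtP i j) => // ij; exfalso; apply: inj.
    by exists i, j.
  by exists j, i.
by apply: subset_card_le => _ [i /= ip <-]; case: (fP i).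
Qed.

End Metric.

(** * Two sweeps *)

Section TwoSweeps.
Variables (R : realType) (X : Type) (d : X -> X -> R) (delta : R) (S : set X).
Hypothesis dP : pseudometric _ _ d.
Hypothesis hyp : delta_hyperbolic d delta.
Hypothesis geo : geodesic_space d.

Variables (x0 z1 z2 : X).
Hypothesis S1 : S z1.
Hypothesis S2 : S z2.
Hypothesis far1 : forall s, S s -> d x0 s <= d x0 z1.
Hypothesis far2 : forall s, S s -> d z1 s <= d z1 z2.

Lemma one_center_dominates c (C : set X) : C c -> (C #<= `I_1)%card ->
  d z1 c = d z1 z2 / 2 -> d z1 c + d c x0 = d z1 x0 ->
  dominates d C (p_radius d 1 S + delta) S.
Proof.
move=> Cc C1 zc zcx; have d0 := pseudometric_ge0 _ _ _ dP z1 z2.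
have del0 := delta_hyperbolic_ge0 _ _ _ dP _ hyp geo x0.
(* This serves twice: as the witness that [p_radius_ge] asks for, and, combined with the lower bound
   on the radius, as the conclusion. *)
have dom : dominates d C (d z1 z2 / 2 + delta) S.
  move=> s Ss; exists c => //; case: (dP) => _ dC _; rewrite dC.
  apply: (farthest_ball _ _ _ dP _ hyp geo z1 x0) => //; first lra.
    by rewrite far1.
  by have := far2 _ Ss; lra.
have rad : d z1 z2 / 2 <= p_radius d 1 S.
  apply: (p_radius_ge _ _ _ dP S 1%N _ _ _ _ C1 dom (fun i => nth z1 [:: z1; z2] i)).
  - lra.
  - by case=> [|[|]].
  - by case=> [|[|i]] [|[|j]] //= _ _; lra.
by move=> s /dom[c' Cc' le]; exists c' => //; lra.
Qed.

(** By the choice of u, each s is within 2r of z1 or of z2. In the first case [farthest_ball]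
    applies with x0 as the far vertex, in the second with z1. *)
Lemma two_centers_dominate u c1 c2 r (C : set X) :
  S u -> 2 * r = Num.min (d z1 u) (d z2 u) ->
  (forall s, S s -> Num.min (d z1 s) (d z2 s) <= Num.min (d z1 u) (d z2 u)) ->
  C c1 -> C c2 -> (C #<= `I_2)%card ->
  d z1 c1 = r -> d z1 c1 + d c1 x0 = d z1 x0 ->
  d z2 c2 = r -> d z2 c2 + d c2 z1 = d z2 z1 ->
  dominates d C (p_radius d 2 S + delta) S.
Proof.
move=> Su ru uP Cc1 Cc2 C2 zc1 zcx zc2 zcz.
have [_ dC _] := dP.
have d1 := pseudometric_ge0 _ _ _ dP z1 u; have d2 := pseudometric_ge0 _ _ _ dP z2 u.
have r0 : 0 <= r by rewrite -zc1; apply: pseudometric_ge0.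
have del0 := delta_hyperbolic_ge0 _ _ _ dP _ hyp geo x0.
have dom : dominates d C (r + delta) S.
  move=> s Ss; have := uP _ Ss; rewrite -ru ge_min => /orP[zs|zs].
    exists c1 => //; rewrite dC; apply: (farthest_ball _ _ _ dP _ hyp geo z1 x0) => //.
    exact: far1.
  exists c2 => //; rewrite dC; apply: (farthest_ball _ _ _ dP _ hyp geo z2 z1) => //.
  exact: far2.
have [r1 r2] : 2 * r <= d z1 u /\ 2 * r <= d z2 u by rewrite ru !ge_min !lexx orbT.
have r12 : 2 * r <= d z1 z2 by apply: le_trans (far2 _ Su).
have rad : r <= p_radius d 2 S.
  apply: (p_radius_ge _ _ _ dP S 2%N _ _ _ _ C2 dom (fun i => nth z1 [:: z1; z2; u] i)).
  - lra.
  - by case=> [|[|[|]]].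
  - by case=> [|[|[|i]]] [|[|[|j]]].
by move=> s /dom[c' Cc' le]; exists c' => //; lra.
Qed.

End TwoSweeps.

(** * The algorithm on a geodesic space with queries *)

Definition geom_prog (p : nat) : cmd geom_query :=
  let cell a := (a, WNat 0) in
  let far x C a := Call (QFar x C a 0%N (WNat 0)) in
  let r i := RGet 0 (WNat i) in
  let half e := RDiv e (RNat 2) in
  let sweeps := Seq (far (cell 5) [::] 1%N) (far (cell 1) [::] 2%N) in
  let centers e :=
    Seq (Call (QAlong (cell 1) (cell 5) (half e) 0%N (WNat 0)))
        (Call (QAlong (cell 2) (cell 1) (half e) 0%N (WNat 1))) in
  if p == 1%N then
    Seq sweeps
      (Seq (Call (QDist (cell 1) (cell 2) 0%N (WNat 0)))
           (Call (QAlong (cell 1) (cell 5) (half (r 0)) 0%N (WNat 0))))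
  else
    Seq (Seq sweeps (far (cell 1) [:: cell 2] 3%N))
      (Seq (Seq (Call (QDist (cell 1) (cell 3) 0%N (WNat 0)))
                (Call (QDist (cell 2) (cell 3) 0%N (WNat 1))))
           (If (RLe (r 0) (r 1)) (centers (r 0)) (centers (r 1)))).

Section GeomProg.
Variables (R : realType) (X : metricType R) (delta : R) (S : set X) (x0 : X).
Variables (far : X -> seq X -> seq X) (geo : X -> X -> R -> X) (tX : nat).
Let d := @mdist R X.
Hypothesis geoX : geodesic_space d.
Hypothesis hyp : delta_hyperbolic d delta.
Hypothesis finS : finite_set S.
Hypothesis farP : farthest_oracle d S far.
Hypothesis geoP : forall x y, is_geodesic d x y (geo x y).
Hypothesis tX0 : (0 < tX)%N.

Lemma mdist_pseudometric : pseudometric _ _ d.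
Proof.
split; [exact: mdistxx|exact: metric_sym|].
by move=> x y z; exact: metric_triangle.
Qed.

(** A nonempty finite S has a maximizer, so the list of the oracle is nonempty and the default y is
    not returned by accident. *)
Lemma far_head y x C : S !=set0 -> let s := nth y (far x C) 0 in
  S s /\ forall s', S s' -> dist_to d x C s' <= dist_to d x C s.
Proof.
move=> S0 s; have [_ farE] := farP x C; apply/(farE s)/mem_nth.
case E : (far x C) => [|//]; exfalso.
have [s0 Ss0] := S0; have /finite_seqP[F FE] := finS.
have s0F : s0 \in F by move: Ss0; rewrite FE.
have i0P : (index s0 F < size F)%N by rewrite index_mem.
have [i _ imax] := @arg_maxP _ R _ (Ordinal i0P) xpredT (fun i => dist_to d x C (nth y F i)) isT.
have : nth y F i \in far x C.
  apply/farE; split; first by rewrite FE /=; exact: mem_nth.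
  move=> s'; rewrite FE /= => s'F; have iP : (index s' F < size F)%N by rewrite index_mem.
  by have := imax (Ordinal iP) isT; rewrite /= nth_index.
by rewrite E.
Qed.

Lemma geo_dist x y t : 0 <= t <= d x y ->
  d x (geo x y t) = t /\ d x (geo x y t) + d (geo x y t) y = d x y.
Proof.
move=> tl; rewrite (is_geodesic_dist0 _ _ _ mdist_pseudometric _ (geoP x y)) //.
rewrite (is_geodesic_dist1 _ _ _ mdist_pseudometric _ (geoP x y)) //; split=> //.
by rewrite addrC subrK.
Qed.

Lemma geom_progP (p : nat) : p = 1%N \/ p = 2%N ->
  exists (st : state R X) (time : nat),
    [/\ exec (geom_step d far geo tX) (geom_prog p) (geom_input R x0) st time,
        time%:R <= 9%:R * ((2 * delta + 1) * tX%:R) &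
        dominates d (geom_output p st) (p_radius d p S + delta) S].
Proof.
move=> hp; pose z1 := nth x0 (far x0 [::]) 0; pose z2 := nth x0 (far z1 [::]) 0.
pose u := nth x0 (far z1 [:: z2]) 0.
have dP := mdist_pseudometric; have [_ dC dT] := dP.
have del0 := delta_hyperbolic_ge0 _ _ _ dP _ hyp geoX x0.
(* For p = 2 the three searches cost 1 + 1 + 2 units of [tX], the two distances 2 and the two
   placements 2; the single test is paid by a ninth unit because [tX > 0]. *)
have time_le (t : nat) : (t <= 9 * tX)%N ->
    t%:R <= 9%:R * ((2 * delta + 1) * tX%:R) :> R.
  rewrite -(ler_nat R) natrM => tle; apply: le_trans tle _.
  rewrite ler_pM2l ?ltr0n // -[leLHS]mul1r ler_pM2r ?ltr0n //; lra.
(* For empty S the points z1, z2, u have no meaning, but domination is vacuous. *)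
have domS st : (S !=set0 -> dominates d (geom_output p st) (p_radius d p S + delta) S) ->
    dominates d (geom_output p st) (p_radius d p S + delta) S.
  by move=> H s Ss; apply: (H _ s Ss); exists s.
have far1 (S0 : S !=set0) : S z1 /\ forall s, S s -> d x0 s <= d x0 z1.
  have [Sz1] := far_head x0 x0 [::] S0; rewrite -/z1 => le1; split=> // s /le1.
  by rewrite /dist_to !big_nil !(dC x0).
have far2 (S0 : S !=set0) : S z2 /\ forall s, S s -> d z1 s <= d z1 z2.
  have [Sz2] := far_head x0 z1 [::] S0; rewrite -/z2 => le2; split=> // s /le2.
  by rewrite /dist_to !big_nil !(dC z1).
have far3 (S0 : S !=set0) : S u /\
    forall s, S s -> Num.min (d z1 s) (d z2 s) <= Num.min (d z1 u) (d z2 u).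
  have [Su] := far_head x0 z1 [:: z2] S0; rewrite -/u => le3; split=> // s /le3.
  rewrite /dist_to !big_cons !big_nil !(dC _ z1) !(dC _ z2).
  by rewrite ![Num.min (d z2 _) _]minC.
have [d0 d1 d2 dx] : [/\ 0 <= d z1 z2, 0 <= d z1 u, 0 <= d z2 u & 0 <= d z1 x0].
  by split; apply: (pseudometric_ge0 _ _ _ dP).
(* Since z1 is farthest from x0, this gives d(z1, z2) <= 2 d(z1, x0): the segment [z1, x0] is long
   enough to carry the center. *)
have T12 := dT z1 x0 z2.
case: hp domS => ->{p} domS.
  eexists; eexists; split.
  (* The final state is found by unification. Point array 5 is never written, so its cell 0 still
     holds x0. *)
  - do !econstructor.
  - apply: time_le; rewrite /=; lia.
  - apply: domS => S0; have [Sz1 F1] := far1 S0; have [Sz2 F2] := far2 S0.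
    have h0 : 0 <= d z1 z2 / 2 <= d z1 x0.
      by have := F1 _ Sz2; rewrite (dC x0 z1); lra.
    have [e1 e2] := geo_dist _ _ _ h0.
    apply: (one_center_dominates _ _ _ _ S dP hyp geoX x0 z1 z2 Sz1 Sz2 F1 F2 (geo z1 x0 (d z1 z2 / 2))) => //.
      by exists 0%N.
    exact: card_image_le.
pose r := Num.min (d z1 u) (d z2 u) / 2.
have Hc st : points st 0%N 0%N = geo z1 x0 r -> points st 0%N 1%N = geo z2 z1 r ->
    dominates d (geom_output 2 st) (p_radius d 2 S + delta) S.
  move=> c1 c2; apply: domS => S0; have [Sz1 F1] := far1 S0; have [Sz2 F2] := far2 S0.
  have [Su F3] := far3 S0.
  have rle : 0 <= r /\ r <= d z1 u / 2 /\ r <= d z2 u / 2.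
    by rewrite /r; case: (lerP (d z1 u)); lra.
  have h1 : 0 <= r <= d z1 x0.
    have := F1 _ Sz2; have := F2 _ Su; rewrite (dC x0 z1).
    by lra.
  have h2 : 0 <= r <= d z2 z1.
    by have := F2 _ Su; rewrite (dC z2 z1); lra.
  have [e1 e2] := geo_dist _ _ _ h1; have [e3 e4] := geo_dist _ _ _ h2.
  apply: (two_centers_dominate _ _ _ _ S dP hyp geoX x0 z1 z2 Sz1 Sz2 F1 F2 u (geo z1 x0 r) (geo z2 z1 r) r) => //.
  - by rewrite /r; lra.
  - by exists 0%N => //; rewrite c1.
  - by exists 1%N => //; rewrite c2.
  - exact: card_image_le.
have [le12|lt12] := leP (d z1 u) (d z2 u).
  eexists; eexists; split.
  - rewrite /geom_prog /=; apply: ExecSeq; first by do !econstructor.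
    apply: ExecSeq; first by do !econstructor.
    apply: ExecIf; rewrite /= /update /= -/z1 -/z2 -/u le12; do !econstructor.
  - apply: time_le; rewrite /=; lia.
  - by apply: Hc; rewrite /= /update /= -/z1 -/z2 -/u /r min_l.
eexists; eexists; split.
- rewrite /geom_prog /=; apply: ExecSeq; first by do !econstructor.
  apply: ExecSeq; first by do !econstructor.
  apply: ExecIf; rewrite /= /update /= -/z1 -/z2 -/u leNgt lt12; do !econstructor.
- apply: time_le; rewrite /=; lia.
- by apply: Hc; rewrite /= /update /= -/z1 -/z2 -/u /r min_r // ltW.
Qed.

End GeomProg.

(** * The metric of a graph *)

(* [simpl] turns true%:R into 1, which [lra] does not see through. *)
Local Ltac slra := simpl in *; lra.

Section GraphMetric.
Variables (R : realType) (n : nat) (e : rel 'I_n).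
Hypothesis simple : simple_graph e.
Hypothesis conn : connected_graph e.
Local Notation X := (graph_point R e).
Local Notation d := (@graph_dist R n e).
Local Notation describes := (@describes R n e).

Let eC a b : e a b = e b a. Proof. by case: simple => eC _; rewrite eC. Qed.

Lemma barycentre_val (u v i : 'I_n) (t : R) :
  ((1 - t) *: delta_mx 0 u + t *: delta_mx 0 v : 'rV_n) 0 i =
  (1 - t) * (i == u)%:R + t * (i == v)%:R.
Proof. by rewrite !mxE. Qed.

Lemma describes_val {u v t x} : describes (u, v, t) x ->
  forall i, val x 0 i = (1 - t) * (i == u)%:R + t * (i == v)%:R.
Proof. by case=> _ _ -> i; exact: barycentre_val. Qed.

Lemma describes_inj {c x y} : describes c x -> describes c y -> x = y.
Proof. by case: c => [[u v] t] [_ _ vx] [_ _ vy]; apply: val_inj; rewrite vx vy. Qed.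

Lemma describes_swap {u v t x} : describes (u, v, t) x -> describes (v, u, 1 - t) x.
Proof.
case=> uv tl vx; split; [by rewrite eq_sym eC|lra|].
by rewrite vx subKr addrC.
Qed.

(** When both ends coincide the parameter carries no information, while formulas such as [L u + t]
    would count it as a length. Hence the normal form [u = v -> t = 0] demanded of descriptions from
    here on. *)
Lemma describes_same {u v t x} : describes (u, v, t) x -> u = v ->
  forall t', 0 <= t' <= 1 -> describes (u, v, t') x.
Proof.
case=> uv tl vx uvE t' t'l; split=> //; rewrite vx -uvE -!scalerDl.
by congr (_ *: _); lra.
Qed.

Lemma describes_ex {u v} t : (u == v) || e u v -> 0 <= t <= 1 ->
  exists x, describes (u, v, t) x.
Proof.
move=> uv tl.
pose z : 'rV[R]_n := (1 - t) *: delta_mx 0 u + t *: delta_mx 0 v.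
have zE i : z 0 i = (1 - t) * (i == u)%:R + t * (i == v)%:R by rewrite !mxE.
suff zP : on_graph e z by exists (exist _ z zP).
apply/and3P; split.
- apply/forallP => i; rewrite zE; case: (i == u); case: (i == v); rewrite /=; lra.
- apply/eqP; under eq_bigr do rewrite zE.
  rewrite big_split /= -!mulr_sumr.
  have sum1 w : \sum_(i < n) (i == w)%:R = 1 :> R.
    rewrite (bigD1 w) //= eqxx big1 ?addr0 // => i /negbTE->.
    by [].
  rewrite !sum1; lra.
- apply/existsP; exists u; apply/existsP; exists v; rewrite /on_cell uv.
  apply/forallP => i; apply/implyP; rewrite zE.
  by case: (i == u); case: (i == v) => //; rewrite !mulr0 addr0 eqxx.
Qed.

Lemma on_cell_describes {u v} {x : X} : on_cell e u v (val x) ->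
  exists t, describes (u, v, t) x.
Proof.
case/andP=> uv /forallP supp; have /and3P[/forallP x0 /eqP x1 _] := valP x.
have x_out i : i != u -> i != v -> val x 0 i = 0.
  move=> iu iv; apply/eqP; apply: contraTT (supp i) => xi.
  by rewrite xi (negbTE iu) (negbTE iv).
have [uvE|uvN] := eqVneq u v.
  have xu : val x 0 u = 1.
    rewrite -x1 (bigD1 u) //= big1 ?addr0 // => i iu; apply: x_out => //.
    by rewrite -uvE.
  exists 0; split=> //; first lra; apply/rowP => i; rewrite barycentre_val -uvE.
  have [->|iu] := eqVneq i u; first by rewrite xu /=; lra.
  rewrite x_out -?uvE //=; lra.
have xuv : val x 0 u = 1 - val x 0 v.
  have : \sum_i val x 0 i = val x 0 u + val x 0 v.
    rewrite (bigD1 u) //= (bigD1 v) //=; last by rewrite eq_sym.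
    by rewrite big1 ?addr0 // => i /andP[iu iv]; apply: x_out.
  by rewrite x1; lra.
exists (val x 0 v); split=> //.
  have xu0 : 0 <= val x 0 u by exact: x0.
  have xv0 : 0 <= val x 0 v by exact: x0.
  by apply/andP; split; lra.
apply/rowP => i; rewrite barycentre_val.
have [->|iu] := eqVneq i u.
  by rewrite (negbTE uvN) xuv /=; lra.
have [->|iv] := eqVneq i v; first by rewrite /=; lra.
by rewrite x_out //=; lra.
Qed.

Lemma describes_on_cell {u v t x} : describes (u, v, t) x -> on_cell e u v (val x).
Proof.
move=> cx; have [uv _ _] := cx; rewrite /on_cell uv; apply/forallP => i.
apply/implyP; rewrite (describes_val cx).
by case: (i == u); case: (i == v) => //; rewrite !mulr0 addr0 eqxx.
Qed.

Lemma point_describes (x : X) : exists u v t, describes (u, v, t) x.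
Proof.
have /and3P[_ _ /existsP[u /existsP[v uvx]]] := valP x.
by have [t tx] := on_cell_describes uvx; exists u, v, t.
Qed.

Lemma same_cellP {x y : X} : same_cell x y ->
  exists u v t t', describes (u, v, t) x /\ describes (u, v, t') y.
Proof.
case/existsP=> u /existsP[v /andP[/on_cell_describes[t tx] /on_cell_describes[t' ty]]].
by exists u, v, t, t'.
Qed.

Lemma describes_same_cell {u v t t' x y} :
  describes (u, v, t) x -> describes (u, v, t') y -> same_cell x y.
Proof.
move=> cx cy; apply/existsP; exists u; apply/existsP; exists v.
by rewrite (describes_on_cell cx) (describes_on_cell cy).
Qed.

Lemma seg_describes {u v t t' x y} : describes (u, v, t) x -> describes (u, v, t') y ->
  seg_length x y = if u == v then 0 else `|t - t'|.
Proof.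
move=> cx cy; rewrite /seg_length.
have E i : val x 0 i - val y 0 i = (t' - t) * ((i == u)%:R - (i == v)%:R).
  by rewrite (describes_val cx) (describes_val cy); ring.
under eq_bigr do rewrite E normrM.
rewrite -mulr_sumr; have [->|uv] := eqVneq u v.
  rewrite big1 ?mulr0 ?mul0r // => i _; by rewrite subrr normr0.
rewrite (bigD1 u) //= (bigD1 v) //=; last by rewrite eq_sym.
rewrite big1; last by move=> i /andP[/negbTE-> /negbTE->]; rewrite subrr normr0.
rewrite !eqxx (negbTE uv) (eq_sym v) (negbTE uv) subr0 sub0r normrN normr1 addr0 distrC.
by field.
Qed.

Lemma seg_le {u v t t' x y} : describes (u, v, t) x -> describes (u, v, t') y ->
  seg_length x y <= `|t - t'|.
Proof. by move=> cx cy; rewrite (seg_describes cx cy); case: ifP => _. Qed.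

Lemma seg_ge0 (x y : X) : 0 <= seg_length x y.
Proof. by rewrite divr_ge0 ?sumr_ge0. Qed.

Lemma seg_sym (x y : X) : seg_length x y = seg_length y x.
Proof. by rewrite /seg_length; under eq_bigr do rewrite distrC. Qed.

Fact vertex_subproof u : on_graph e (delta_mx 0 u : 'rV[R]_n).
Proof.
have uu : (u == u) || e u u by rewrite eqxx.
have t0 : 0 <= (0 : R) <= 1 by rewrite lexx ler01.
have [x [_ _ vx]] := describes_ex 0 uu t0.
have -> : delta_mx 0 u = val x by rewrite vx subr0 scale1r scale0r addr0.
exact: valP.
Qed.

Definition vertex (u : 'I_n) : X :=
  exist (fun x => on_graph e x) (delta_mx 0 u) (vertex_subproof u).

Lemma describes_vertex0 {u v} : (u == v) || e u v -> describes (u, v, 0) (vertex u).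
Proof. by move=> uv; split=> //; [lra | rewrite subr0 scale1r scale0r addr0]. Qed.

Lemma describes_vertex1 {u v} : (u == v) || e u v -> describes (u, v, 1) (vertex v).
Proof. by move=> uv; split=> //; [lra | rewrite subrr scale1r scale0r add0r]. Qed.

(** Stands in for [graph_dist x y <= l] until the infimum is known to be attained. *)
Definition path_within (x y : X) (l : R) : Prop :=
  exists s, [/\ path (@same_cell R n e) x s, last x s = y & path_length x s <= l].

Lemma path_length_cat (x : X) s1 s2 :
  path_length x (s1 ++ s2) = path_length x s1 + path_length (last x s1) s2.
Proof. by elim: s1 x => [|y s IH] x /=; rewrite ?add0r // IH addrA. Qed.

Lemma path_length_ge0 (x : X) s : 0 <= path_length x s.
Proof. by elim: s x => [|y s IH] x //=; rewrite addr_ge0 ?seg_ge0. Qed.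

Lemma path_within_refl x l : 0 <= l -> path_within x x l.
Proof. by exists [::]. Qed.

Lemma path_within_le x y l l' : path_within x y l -> l <= l' -> path_within x y l'.
Proof. by case=> s [ps ls le] le'; exists s; split=> //; apply: le_trans le'. Qed.

Lemma path_within_trans {x y z l l'} : path_within x y l -> path_within y z l' -> path_within x z (l + l').
Proof.
case=> s [ps ls le] [s' [ps' ls' le']]; exists (s ++ s'); split.
- by rewrite cat_path ps ls.
- by rewrite last_cat ls.
- by rewrite path_length_cat ls lerD.
Qed.

Lemma path_within_seg {u v t t' x y} : describes (u, v, t) x -> describes (u, v, t') y ->
  path_within x y `|t - t'|.
Proof.
move=> cx cy; exists [:: y]; split=> //=.
  by rewrite andbT; apply: describes_same_cell cx cy.
by rewrite addr0 (seg_le cx cy).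
Qed.

Lemma path_within_sym {x y l} : path_within x y l -> path_within y x l.
Proof.
suff H s : path (@same_cell R n e) x s -> path_within (last x s) x (path_length x s).
  by case=> s [ps <- le]; apply: path_within_le le; apply: H.
elim: s x => [|z s IH] x /=; first by move=> _; apply: path_within_refl.
case/andP=> xz ps; rewrite addrC; apply: (path_within_trans (IH _ ps)).
exists [:: x]; split=> //=; last by rewrite addr0 seg_sym.
have [u [v [t [t' [cx cz]]]]] := same_cellP xz.
by rewrite andbT; apply: describes_same_cell cz cx.
Qed.

(** The support of an interior point consists of both ends of its edge. A path can therefore change
    edges only at a vertex. *)
Lemma describes_uniq {u v t a b q x} : u != v -> 0 < t < 1 ->
  describes (u, v, t) x -> describes (a, b, q) x ->
  [/\ a = u, b = v & q = t] \/ [/\ a = v, b = u & q = 1 - t].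
Proof.
move=> uv /andP[t0 t1] cx cx'.
have E i := etrans (esym (describes_val cx i)) (describes_val cx' i).
have := E u; have := E v; rewrite !eqxx (negbTE uv) (eq_sym v u) (negbTE uv).
rewrite (eq_sym u a) (eq_sym u b) (eq_sym v a) (eq_sym v b).
have [au|au] := eqVneq a u; have [bu|bu] := eqVneq b u => /=; rewrite ?au ?bu.
- by rewrite !(negbTE uv); lra.
- by rewrite !(negbTE uv); have [->|bv] := eqVneq b v => /= *; [left; split=> //|]; lra.
- by rewrite !(negbTE uv); have [->|av] := eqVneq a v => /= *; [right; split=> //|]; lra.
- by lra.
Qed.

(** A certificate of exact distances from x: the paths bound them from above, while the values at u
    and v and the growth by at most 1 along edges bound every path from below, as a potential
    does. *)
Definition distance_labels (u v : 'I_n) (t : R) (x : X) (L : 'I_n -> R) : Prop :=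
  [/\ describes (u, v, t) x, u = v -> t = 0, L u <= t /\ L v <= 1 - t,
      forall a b, e a b -> L b <= L a + 1 & forall a, path_within x (vertex a) (L a)].

Section LowerBound.
Variables (u v : 'I_n) (t : R) (x : X) (L : 'I_n -> R).
Hypothesis labels : distance_labels u v t x L.

(** The quantity [1 - val y 0 w] is the distance from w to y inside a cell that contains both, so l
    pays for reaching w at its label and then going straight to y. *)
Definition via_vertex (y : X) (l : R) : Prop :=
  exists w, val y 0 w != 0 /\ L w + 1 - val y 0 w <= l.

Lemma via_vertex_step y y' l : same_cell y y' -> via_vertex y l ->
  via_vertex y' (l + seg_length y y').
Proof.
have [_ _ _ Llip _] := labels.
case/same_cellP=> a [b [q [q' [cy cy']]]].
have [ab|ab] := eqVneq a b.
  have q0 : 0 <= (0 : R) <= 1 by rewrite lexx ler01.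
  have -> : y' = y.
    exact: describes_inj (describes_same cy' ab _ q0) (describes_same cy ab _ q0).
  by case=> w [yw le]; exists w; split=> //; have := seg_ge0 y y; slra.
case=> w [yw le].
wlog wa : a b q q' cy cy' ab / w = a.
  move=> H; have [wa|wa] := eqVneq w a; first exact: H cy cy' ab wa.
  apply: H (describes_swap cy) (describes_swap cy') _ _; first by rewrite eq_sym.
  move: yw; rewrite (describes_val cy) (negbTE wa) mulr0 add0r.
  by have [->|] := eqVneq w b; rewrite // mulr0 eqxx.
rewrite (seg_describes cy cy') (negbTE ab) in le *.
have [eab ql _] := cy; have [_ ql' _] := cy'; rewrite (negbTE ab) /= in eab.
move: yw le; rewrite wa (describes_val cy) eqxx (negbTE ab) => yw le.
have := ler_norm (q' - q); rewrite distrC => qq.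
(* The vertex a remains a valid witness unless the step ends exactly at b, where a has weight 0;
   then b takes over, and the Lipschitz condition pays for the edge. *)
have [q1|q1] := eqVneq q' 1.
  exists b; rewrite (describes_val cy') eqxx (eq_sym b a) (negbTE ab) q1.
  rewrite q1 in qq; split; first by rewrite subrr mul0r add0r mulr1 oner_eq0.
  by have := Llip _ _ eab; slra.
exists a; rewrite (describes_val cy') eqxx (negbTE ab); split; last slra.
by rewrite mulr1 mulr0 addr0 subr_eq0 eq_sym.
Qed.

(** At u or v the next segment may enter another edge, so a direct path that stops there is
    reclassified. What remains is an interior point, whose next segment stays on uv. *)
Lemma direct_via_vertex y t' l : describes (u, v, t') y -> `|t - t'| <= l ->
  (u != v /\ 0 < t' < 1) \/ via_vertex y l.
Proof.
have [_ t0 [Lu Lv] _ _] := labels => cy le.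
have [_ tl _] := cy; have := ler_norm (t - t'); have := ler_norm (t' - t).
rewrite distrC => l1 l2.
have [uv|uv] := eqVneq u v.
  right; exists u; rewrite (describes_val cy) eqxx -uv eqxx.
  have := t0 uv; have : 1 - t' + t' = 1 by rewrite subrK.
  by rewrite !mulr1 => ->; rewrite oner_eq0; split=> //; slra.
have [t'0|t'0] := eqVneq t' 0.
  right; exists u; rewrite (describes_val cy) eqxx (negbTE uv) t'0 subr0 mulr1 mul0r addr0.
  by rewrite oner_eq0; split=> //; slra.
have [t'1|t'1] := eqVneq t' 1.
  right; exists v; rewrite (describes_val cy) eqxx (eq_sym v) (negbTE uv) t'1 subrr mul0r mulr1 add0r.
  by rewrite oner_eq0; split=> //; slra.
left; split=> //; rewrite !lt_neqAle t'1 eq_sym t'0 /=; slra.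
Qed.

(** Induction on the last segment. A path either has stayed on the source edge, and is at least as
    long as its net displacement, or has been charged to a vertex, which [via_vertex_step] maintains
    forever. *)
Lemma path_lower s : path (@same_cell R n e) x s ->
  (exists t', describes (u, v, t') (last x s) /\ `|t - t'| <= path_length x s) \/
  via_vertex (last x s) (path_length x s).
Proof.
have [cx _ _ _ _] := labels.
elim/last_ind: s => [|s y' IH] /=.
  by move=> _; left; exists t; rewrite subrr normr0.
rewrite rcons_path last_rcons -cats1 path_length_cat /= addr0 => /andP[ps yy'].
set y := last x s in yy' IH *.
have [[t' [cy le]]|vy] := IH ps; last by right; apply: via_vertex_step.
have [[uv t'l]|vy] := direct_via_vertex _ _ _ cy le; last by right; apply: via_vertex_step.
left; have [a [b [q [q' [dy dy']]]]] := same_cellP yy'.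
have [[au bv qt]|[av bu qt]] := describes_uniq uv t'l cy dy.
  rewrite au bv in dy'; exists q'; split=> //.
  rewrite (seg_describes cy dy') (negbTE uv); apply: le_trans (ler_distD t' _ _) _.
  by rewrite lerD2r.
rewrite av bu in dy'; have {}dy' := describes_swap dy'; exists (1 - q'); split=> //.
rewrite (seg_describes cy dy') (negbTE uv); apply: le_trans (ler_distD t' _ _) _.
by rewrite lerD2r.
Qed.

(** The routes from x to the point (a, b, q) lead through a, through b, or along a common edge,
    which the two descriptions may orient differently. The nested tests are those of [dist_cmd]. *)
Definition label_dist (a b : 'I_n) (q : R) : R :=
  let m := Num.min (L a + q) (L b + (1 - q)) in
  let m := if (u == a) && (v == b) then Num.min m `|t - q| else m in
  if (u == b) && (v == a) then Num.min m `|t - (1 - q)| else m.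

Lemma label_dist_le a b q :
  [/\ label_dist a b q <= L a + q, label_dist a b q <= L b + (1 - q),
      u = a -> v = b -> label_dist a b q <= `|t - q| &
      u = b -> v = a -> label_dist a b q <= `|t - (1 - q)|].
Proof.
rewrite /label_dist; split.
- by do 2?[case: ifP => _]; rewrite ?ge_min ?lexx ?orbT.
- by do 2?[case: ifP => _]; rewrite ?ge_min ?lexx ?orbT.
- by move=> -> ->; rewrite !eqxx /=; case: ifP => _; rewrite ?ge_min ?lexx ?orbT.
- by move=> -> ->; rewrite !eqxx /= ge_min lexx orbT.
Qed.

Lemma path_within_label_dist {a b q y} : describes (a, b, q) y -> path_within x y (label_dist a b q).
Proof.
move=> cy; have [ab ql _] := cy; have [cx _ _ _ nearL] := labels.
have mle l1 l2 : path_within x y l1 -> path_within x y l2 -> path_within x y (Num.min l1 l2).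
  by case: (leP l1 l2).
have na : path_within x y (L a + q).
  apply: path_within_trans (nearL a) _; apply: path_within_le (path_within_seg (describes_vertex0 ab) cy) _.
  by rewrite sub0r normrN ger0_norm //; case/andP: ql.
have nb : path_within x y (L b + (1 - q)).
  apply: path_within_trans (nearL b) _; apply: path_within_le (path_within_seg (describes_vertex1 ab) cy) _.
  by rewrite ger0_norm // subr_ge0; case/andP: ql.
rewrite /label_dist; case: ifP => [/andP[/eqP ub /eqP va]|_].
  apply: (mle); last by rewrite ub va in cx; apply: path_within_seg cx (describes_swap cy).
  case: ifP => [/andP[/eqP ua /eqP vb]|_]; last exact: mle.
  apply: (mle _ _ (mle _ _ na nb)); move: cx; rewrite ua vb => cx; exact: path_within_seg cx cy.
case: ifP => [/andP[/eqP ua /eqP vb]|_]; last exact: mle.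
apply: (mle _ _ (mle _ _ na nb)); move: cx; rewrite ua vb => cx; exact: path_within_seg cx cy.
Qed.

Lemma label_dist_lower {a b q y l} : describes (a, b, q) y -> (a = b -> q = 0) ->
  path_within x y l -> label_dist a b q <= l.
Proof.
move=> cy q0 [s [ps ls le]]; apply: le_trans le.
have [m1 m2 m3 m4] := label_dist_le a b q.
have via : via_vertex y (path_length x s) -> label_dist a b q <= path_length x s.
  case=> w []; rewrite (describes_val cy).
  have [ab|ab] := eqVneq a b.
    rewrite (q0 ab) -ab subr0 mul1r mul0r addr0 in m1 *.
    have [->|wa] := eqVneq w a => yw le; [slra | by move: yw; rewrite /= ?addr0 ?eqxx].
  have [->|wa] := eqVneq w a; first by rewrite (negbTE ab) => _ le; slra.
  by have [->|wb] := eqVneq w b => yw le; [slra | rewrite !mulr0 addr0 eqxx in yw].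
have := path_lower _ ps; rewrite ls => -[[t' [cy' le']]|/via //].
have [[uv t'l]|/via //] := direct_via_vertex _ _ _ cy' le'.
apply: le_trans le'.
have [[au bv qt]|[av bu qt]] := describes_uniq uv t'l cy' cy.
  by apply: le_trans (m3 _ _) _; rewrite ?qt.
by apply: le_trans (m4 _ _) _; rewrite ?qt // subKr.
Qed.

End LowerBound.

Lemma hops_subproof u v : exists k, [exists p : k.-tuple 'I_n, path e u p && (last u p == v)].
Proof.
have [_ /(_ u v)/connectP[p pp ->]] := conn.
by exists (size p); apply/existsP; exists (in_tuple p); rewrite pp eqxx.
Qed.

Definition hops u v : nat := ex_minn (hops_subproof u v).

Lemma hopsP u v : exists p, [/\ path e u p, last u p = v & size p = hops u v].
Proof.
rewrite /hops; case: ex_minnP => k /existsP[p /andP[pp /eqP lp]] _.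
by exists p; rewrite size_tuple.
Qed.

Lemma hops_le u p : path e u p -> (hops u (last u p) <= size p)%N.
Proof.
move=> pp; rewrite /hops; case: ex_minnP => k _; apply.
by apply/existsP; exists (in_tuple p); rewrite pp eqxx.
Qed.

Lemma hops_edge u a b : e a b -> (hops u b <= hops u a + 1)%N.
Proof.
move=> eab; have [p [pp lp <-]] := hopsP u a.
have := hops_le u (rcons p b); rewrite rcons_path last_rcons size_rcons addn1.
by rewrite lp eab pp => ->.
Qed.

Lemma path_within_hops u v : path_within (vertex u) (vertex v) (hops u v)%:R.
Proof.
have [p [pp <- <-]] := hopsP u v; elim: p u pp => [|w p IH] u /=.
  by move=> _; apply: path_within_refl.
case/andP=> uw pp; rewrite -natr1 addrC; apply: path_within_trans (IH _ pp).
have cell : (u == w) || e u w by rewrite uw orbT.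
apply: path_within_le (path_within_seg (describes_vertex0 cell) (describes_vertex1 cell)) _.
by rewrite sub0r normrN normr1.
Qed.

Lemma normal_describes (x : X) : exists u v t, describes (u, v, t) x /\ (u = v -> t = 0).
Proof.
have [u [v [t cx]]] := point_describes x; have [uv|uv] := eqVneq u v.
  exists u, v, 0; split=> //; apply: describes_same cx uv _ _.
  by rewrite lexx ler01.
by exists u, v, t; split=> // uvE; rewrite uvE eqxx in uv.
Qed.

(** Hop counts from the two ends of the source edge provide labels without running a program, so the
    metric is settled before the search is analysed. *)
Lemma distance_labels_ex {u v t x} : describes (u, v, t) x -> (u = v -> t = 0) ->
  exists L, distance_labels u v t x L.
Proof.
move=> cx t0; have [uv tl _] := cx.
exists (fun a => Num.min (t + (hops u a)%:R) (1 - t + (hops v a)%:R)).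
have hops0 w : hops w w = 0%N.
  by apply/eqP; rewrite -leqn0; apply: (hops_le w [::]).
split=> //.
- by rewrite !hops0 !addr0 !ge_min !lexx orbT.
- move=> a b eab; have hE w : (hops w b)%:R <= (hops w a)%:R + 1 :> R.
    by rewrite natr1 ler_nat -addn1 hops_edge.
  have hu := hE u; have hv := hE v.
  have [h|h] := leP (t + (hops u a)%:R) (1 - t + (hops v a)%:R);
    by rewrite ge_min; apply/orP; first [left; lra | right; lra].
- move=> a; have nu : path_within x (vertex u) t.
    apply: path_within_le (path_within_seg cx (describes_vertex0 uv)) _.
    by rewrite subr0 ger0_norm //; case/andP: tl.
  have nv : path_within x (vertex v) (1 - t).
    apply: path_within_le (path_within_seg cx (describes_vertex1 uv)) _.
    by rewrite distrC ger0_norm // subr_ge0; case/andP: tl.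
  have [_|_] := leP (t + (hops u a)%:R) (1 - t + (hops v a)%:R).
    by apply: path_within_trans nu _; apply: path_within_hops.
  by apply: path_within_trans nv _; apply: path_within_hops.
Qed.

(** The infimum is a minimum: [label_dist] bounds all path lengths from below and is realised by a
    path. *)
Lemma graph_dist_near_le x y : path_within x y (d x y) /\ forall l, path_within x y l -> d x y <= l.
Proof.
have [u [v [t [cx t0]]]] := normal_describes x.
have [a [b [q [cy q0]]]] := normal_describes y.
have [L labels] := distance_labels_ex cx t0.
have nD := path_within_label_dist _ _ _ _ _ labels cy.
set D := label_dist _ _ _ _ _ _ _ in nD.
have lowD l : path_within x y l -> D <= l by exact: (label_dist_lower _ _ _ _ _ labels cy q0).
have dle l : path_within x y l -> d x y <= l.
  case=> s [ps ls le]; apply: le_trans le; apply: ge_inf.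
    by exists 0 => _ [s' _ <-]; apply: path_length_ge0.
  by exists s => //=; rewrite ps ls eqxx.
split=> //; suff -> : d x y = D by [].
apply: le_anti; rewrite dle //=; apply: lb_le_inf.
  by have [s [ps ls _]] := nD; exists (path_length x s), s => //=; rewrite ps ls eqxx.
by move=> _ [s /andP[ps /eqP ls] <-]; apply: lowD; exists s.
Qed.

Lemma graph_dist_near x y : path_within x y (d x y).
Proof. by case: (graph_dist_near_le x y). Qed.

Lemma graph_dist_le {x y l} : path_within x y l -> d x y <= l.
Proof. by case: (graph_dist_near_le x y) => _; apply. Qed.

Lemma graph_dist_labels {u v t x L a b q y} : distance_labels u v t x L ->
  describes (a, b, q) y -> (a = b -> q = 0) -> d x y = label_dist u v t L a b q.
Proof.
move=> labels cy q0; apply: le_anti.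
rewrite (graph_dist_le (path_within_label_dist _ _ _ _ _ labels cy)) /=.
exact: (label_dist_lower _ _ _ _ _ labels cy q0 (graph_dist_near x y)).
Qed.

Lemma graph_pseudometric : pseudometric R X d.
Proof.
have d0 x y : 0 <= d x y.
  by have [s [_ _]] := graph_dist_near x y; apply: le_trans; apply: path_length_ge0.
split.
- by move=> x; apply: le_anti; rewrite d0 andbT; apply: graph_dist_le; apply: path_within_refl.
- by move=> x y; apply: le_anti; rewrite !graph_dist_le //; apply/path_within_sym/graph_dist_near.
- by move=> x y z; apply/graph_dist_le/path_within_trans; apply: graph_dist_near.
Qed.

Lemma graph_segment_path (x y : X) : same_cell x y ->
  exists g, lipschitz_path R X d x y (seg_length x y) g.
Proof.
have dP := graph_pseudometric; have [dxx _ _] := dP.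
move=> /same_cellP[u [v [t [t' [cx cy]]]]]; rewrite (seg_describes cx cy).
have [uv|uv] := eqVneq u v.
  exists (fun=> x); split=> //; last by move=> *; rewrite dxx.
  have t0 : 0 <= (0 : R) <= 1 by rewrite lexx ler01.
  exact: describes_inj (describes_same cx uv _ t0) (describes_same cy uv _ t0).
wlog tt' : u v t t' cx cy uv / t <= t'.
  move=> H; have [tt'|tt'] := leP t t'; first exact: H cx cy uv tt'.
  have -> : t - t' = (1 - t') - (1 - t) by ring.
  rewrite distrC; apply: H (describes_swap cx) (describes_swap cy) _ _; last lra.
  by rewrite eq_sym.
have [cell tl _] := cx; have [_ tl' _] := cy.
rewrite distrC ger0_norm ?subr_ge0 //.
have /choice[g gP] : forall s, exists z, 0 <= s <= t' - t -> describes (u, v, t + s) z.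
  move=> s; have [sl|_] := boolP (0 <= s <= t' - t); last by exists x.
  by have [|z cz] := describes_ex (t + s) cell; [lra | exists z].
have t0 : 0 <= (0 : R) <= t' - t by rewrite lexx subr_ge0.
have t1 : 0 <= t' - t <= t' - t by rewrite ?lexx subr_ge0 tt'.
exists g; split; first by rewrite subr_ge0.
- by apply: describes_inj (gP _ t0) _; rewrite addr0.
- by apply: describes_inj (gP _ t1) _; rewrite addrC subrK.
- move=> s s' sl sl'; apply: graph_dist_le; apply: path_within_le (path_within_seg (gP _ sl) (gP _ sl')) _.
  by have -> : t + s - (t + s') = s - s' by ring.
Qed.

(** The segments of a shortest path, traversed at unit speed, form a 1-Lipschitz path whose length
    is the distance. *)
Lemma graph_geodesic_space : geodesic_space d.
Proof.
have dP := graph_pseudometric; have [dxx _ _] := dP.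
move=> x y; have [s [ps ls le]] := graph_dist_near x y.
suff [g] : exists g, lipschitz_path R X d x y (path_length x s) g.
  have -> : path_length x s = d x y.
    by apply: le_anti; rewrite le; apply: graph_dist_le; exists s.
  by move=> gP; exists g; apply: lipschitz_path_geodesic.
rewrite -{}ls {y le}; elim: s x ps => [|z s IH] x /=.
  by move=> _; exists (fun=> x); split=> // *; rewrite dxx.
case/andP=> /graph_segment_path[g gP] /IH[h hP].
by exists (concat_path R X (seg_length x z) g h); apply: lipschitz_path_concat gP hP.
Qed.

End GraphMetric.

Arguments vertex {R n e} u.
Arguments path_within {R n e}.
Arguments distance_labels {R n e}.
Arguments label_dist {R n}.

(** * Breadth-first search from a point *)

Section Search.
Variables (R : realType) (n : nat) (e : rel 'I_n).
Hypothesis simple : simple_graph e.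
Hypothesis conn : connected_graph e.
Local Notation X := (graph_point R e).

Definition set_at (T : Type) (f : 'I_n -> T) (w : 'I_n) (x : T) : 'I_n -> T :=
  fun v => if v == w then x else f v.

(* The edge from P v to v carries a shortest path from z to v; if L v < 1 it
   also carries z. *)
Definition parent_edge (z : X) (L : 'I_n -> R) (P : 'I_n -> 'I_n) (v : 'I_n) : Prop :=
  (e (P v) v /\ L (P v) + 1 <= L v) \/ @describes R n e (P v, v, 1 - L v) z.

(** The bound n on the labels limits the number of parent steps made by [center_cmd]. *)
Definition search_tree (a b : 'I_n) (t : R) (z : X) L P : Prop :=
  distance_labels a b t z L /\ forall v, L v <= n%:R /\ parent_edge z L P v.

Variables (a b : 'I_n) (t : R) (z : X).
Hypothesis cz : @describes R n e (a, b, t) z.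
Hypothesis norm_z : a = b -> t = 0.

(* The queue is qs, its first h elements have been removed, u was the last one,
   and rest lists the neighbours of u that are still to be examined. *)
Record search_inv (qs : seq 'I_n) (L : 'I_n -> R) (P : 'I_n -> 'I_n) (h : nat)
    (u : 'I_n) (rest : seq 'I_n) : Prop := SearchInv {
  inv_uniq : uniq qs;
  inv_head : (h <= size qs)%N;
  inv_sorted : pairwise (fun v w => L v <= L w) qs;
  inv_span : forall v w, v \in drop h qs -> w \in qs -> L w <= L v + 1;
  inv_cur : rest != [::] -> [/\ u \in qs, {subset rest <= e u},
    forall v, v \in drop h qs -> L u <= L v & forall w, w \in qs -> L w <= L u + 1];
  inv_closed : forall v w, v \in take h qs -> e v w ->
    (w \in qs /\ L w <= L v + 1) \/ (v = u /\ w \in rest);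
  inv_source : [/\ a \in qs, b \in qs, L a <= t & L b <= 1 - t];
  inv_near : forall v, v \in qs -> path_within z (vertex v) (L v);
  inv_tree : forall v, v \in qs ->
    (P v \in qs /\ e (P v) v /\ L (P v) + 1 <= L v) \/
    @describes R n e (P v, v, 1 - L v) z;
  inv_index : forall v, v \in qs -> L v <= (index v qs).+1%:R }.

Lemma search_advance qs L P h u u' A : search_inv qs L P h u [::] ->
  (h < size qs)%N -> nth u' qs h = u' -> A =i e u' ->
  search_inv qs L P h.+1 u' A.
Proof.
move=> I hq hu AE; have E : drop h qs = u' :: drop h.+1 qs.
  by rewrite (drop_nth u') // hu.
have sub v : v \in drop h.+1 qs -> v \in drop h qs by rewrite E inE orbC => ->.
have u'd : u' \in drop h qs by rewrite E mem_head.
have u'q : u' \in qs by apply: mem_drop u'd.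
split; try by case: I.
- by move=> v w /sub; exact: (inv_span _ _ _ _ _ _ I).
- move=> _; split=> //.
  + by move=> w; rewrite AE.
  + move=> v vd; have := inv_sorted _ _ _ _ _ _ I.
    rewrite -(cat_take_drop h qs) pairwise_cat E => /and3P[_ _] /=.
    by case/andP=> /allP H _; apply: H.
  + by move=> w wq; apply: (inv_span _ _ _ _ _ _ I).
- move=> v w; rewrite (take_nth u') // mem_rcons inE hu => /orP[/eqP->|vt] vw.
    by right; rewrite AE.
  by left; have [|[]] := inv_closed _ _ _ _ _ _ I v w vt vw.
Qed.

Lemma search_skip qs L P h u w rest : search_inv qs L P h u (w :: rest) ->
  w \in qs -> search_inv qs L P h u rest.
Proof.
move=> I wq; have [uq subr le1 le2] := inv_cur _ _ _ _ _ _ I isT.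
split; try by case: I.
- by move=> _; split=> // x xr; apply: subr; rewrite inE xr orbT.
- move=> v x vt vx; have [|[vu]] := inv_closed _ _ _ _ _ _ I v x vt vx; first by left.
  rewrite inE => /orP[/eqP->|xr]; last by right.
  by left; rewrite vu; split=> //; apply: le2.
Qed.

(** A plain queue acts as a priority queue: by [inv_cur] no label exceeds [L u + 1], so the new
    label may be appended at the end, and all waiting labels stay at least [L u], which preserves
    the span of 1. *)
Lemma search_push qs L P h u w rest : search_inv qs L P h u (w :: rest) ->
  w \notin qs ->
  search_inv (rcons qs w) (set_at _ L w (L u + 1)) (set_at _ P w u) h u rest.
Proof.
move=> I wq; have [uq subr le1 le2] := inv_cur _ _ _ _ _ _ I isT.
have hq := inv_head _ _ _ _ _ _ I.
have neq v : v \in qs -> (v == w) = false by move=> vq; apply: contraNF wq => /eqP<-.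
have setE T (f : 'I_n -> T) x v : v \in qs -> set_at _ f w x v = f v.
  by move=> vq; rewrite /set_at neq.
have setw T (f : 'I_n -> T) x : set_at _ f w x w = x by rewrite /set_at eqxx.
have dropE : drop h (rcons qs w) = rcons (drop h qs) w by rewrite drop_rcons.
have takeE : take h (rcons qs w) = take h qs.
  by rewrite -cats1 take_cat; case: ltngtP hq => // ->; rewrite subnn take_size cats0.
have euw : e u w by apply: subr; rewrite mem_head.
have dq v : v \in drop h qs -> v \in qs by apply: mem_drop.
have bound v : v \in rcons qs w -> set_at _ L w (L u + 1) v <= L u + 1.
  rewrite mem_rcons inE => /orP[/eqP->|vq]; first by rewrite setw.
  by rewrite setE ?le2.
have lower v : v \in drop h (rcons qs w) -> L u <= set_at _ L w (L u + 1) v.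
  rewrite dropE mem_rcons inE => /orP[/eqP->|vd]; first by rewrite setw lerDl.
  by rewrite setE ?le1 ?dq.
have [aq bq La Lb] := inv_source _ _ _ _ _ _ I.
split.
- by rewrite rcons_uniq wq (inv_uniq _ _ _ _ _ _ I).
- by rewrite size_rcons ltnW.
- rewrite pairwise_rcons; apply/andP; split.
    by apply/allP => v vq /=; rewrite setw setE ?le2.
  rewrite (@eq_in_pairwise _ (mem qs) _ (fun v w => L v <= L w)).
  + exact: inv_sorted _ _ _ _ _ _ I.
  + by move=> x y xq yq; rewrite !setE.
  + exact/allP.
- by move=> v x /lower vd /bound xq; lra.
- move=> _; split.
  + by rewrite mem_rcons inE uq orbT.
  + by move=> x xr; apply: subr; rewrite inE xr orbT.
  + by move=> v /lower; rewrite [set_at _ _ _ _ u]setE.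
  + by move=> x /bound; rewrite [set_at _ _ _ _ u]setE.
- move=> v x; rewrite takeE => vt vx.
  have vq : v \in qs by apply: mem_take vt.
  rewrite mem_rcons inE [set_at _ _ _ _ v]setE //.
  have [[xq Lx]|[vu]] := inv_closed _ _ _ _ _ _ I v x vt vx.
    by left; rewrite xq orbT setE.
  rewrite inE => /orP[/eqP->|xr]; last by right.
  by left; rewrite eqxx setw vu.
- by rewrite !mem_rcons !inE aq bq !orbT !setE.
- move=> v; rewrite mem_rcons inE => /orP[/eqP->|vq].
    rewrite setw; apply: path_within_trans (inv_near _ _ _ _ _ _ I u uq) _.
    have cell : (u == w) || e u w by rewrite euw orbT.
    have := path_within_seg _ _ _ (describes_vertex0 R _ _ cell) (describes_vertex1 R _ _ cell).
    by rewrite sub0r normrN normr1.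
  by rewrite setE //; apply: inv_near _ _ _ _ _ _ I v vq.
- move=> v; rewrite !mem_rcons !inE => /orP[/eqP->|vq].
    by left; rewrite !setw uq orbT euw setE.
  rewrite !(setE _ _ _ v) //.
  have [[Pq [eP LP]]|dz] := inv_tree _ _ _ _ _ _ I v vq; last by right.
  by left; rewrite Pq orbT setE.
- move=> v; rewrite mem_rcons inE -cats1 index_cat => /orP[/eqP->|vq].
    rewrite (negbTE wq) /= eqxx addn0 setw -natr1 lerD2r.
    apply: le_trans (inv_index _ _ _ _ _ _ I u uq) _.
    by rewrite ler_nat index_mem.
  by rewrite vq setE //; apply: inv_index _ _ _ _ _ _ I v vq.
Qed.

(** With every queue element processed, the reached set is closed under adjacency and contains a,
    hence is everything by connectivity. A label is at most the rank in the queue, and the queue has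
    no repetition, so labels are at most n. *)
Lemma search_done qs L P u : search_inv qs L P (size qs) u [::] ->
  (forall v, v \in qs) /\ search_tree a b t z L P.
Proof.
move=> I; have closed v w : v \in qs -> e v w -> w \in qs /\ L w <= L v + 1.
  move=> vq vw; have := inv_closed _ _ _ _ _ _ I v w.
  by rewrite take_size => /(_ vq vw)[|[]].
have [aq bq La Lb] := inv_source _ _ _ _ _ _ I.
have all_q v : v \in qs.
  have [_ /(_ a v)/connectP[p pp ->]] := conn.
  elim: p a aq pp {La} => [|w p IH] x xq //= /andP[xw pp].
  by apply: IH pp; case: (closed _ _ xq xw).
have size_q : (size qs <= n)%N.
  rewrite -[leqRHS]card_ord -(card_uniqP (inv_uniq _ _ _ _ _ _ I)).
  exact: max_card.
split=> //; split.
  split=> //.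
  - by move=> v w vw; case: (closed v w (all_q v) vw).
  - by move=> v; apply: inv_near _ _ _ _ _ _ I v (all_q v).
move=> v; split.
  apply: le_trans (inv_index _ _ _ _ _ _ I v (all_q v)) _.
  by rewrite ler_nat (leq_trans _ size_q) // index_mem.
by have [[_ []]|] := inv_tree _ _ _ _ _ _ I v (all_q v); [left|right].
Qed.

Let ab_cell : (a == b) || e a b. Proof. by case: cz. Qed.

Lemma path_within_source : path_within z (vertex a) t /\ path_within z (vertex b) (1 - t).
Proof.
have [_ tl _] := cz; split.
  apply: path_within_le (path_within_seg _ _ _ cz (describes_vertex0 R _ _ ab_cell)) _.
  by rewrite subr0 ger0_norm //; case/andP: tl.
apply: path_within_le (path_within_seg _ _ _ cz (describes_vertex1 R _ _ ab_cell)) _.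
by rewrite distrC ger0_norm // subr_ge0; case/andP: tl.
Qed.

Lemma search_start_vertex L P u : a = b -> L a = t -> P a = b ->
  search_inv [:: a] L P 0 u [::].
Proof.
move=> ab La Pa; have [na nb] := path_within_source; have t0 := norm_z ab.
have [_ tl _] := cz.
split=> //.
- by move=> v w; rewrite !inE => /eqP-> /eqP->; rewrite lerDl.
- rewrite -ab mem_head La; split=> //; lra.
- by move=> v; rewrite inE => /eqP->; rewrite La.
- move=> v; rewrite inE => /eqP->; right; rewrite Pa La.
  exact: describes_swap.
- by move=> v; rewrite inE => /eqP->; rewrite La /= eqxx; lra.
Qed.

(** The nearer end comes first to keep the queue sorted, and 1 - 2t <= 1 gives the span. Each end is
    the parent of the other because the source lies between them, the second alternative of
    [parent_edge]. *)
Lemma search_start_edge L P u : a != b -> t <= 1 - t -> L a = t -> P a = b ->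
  L b = 1 - t -> P b = a -> search_inv [:: a; b] L P 0 u [::].
Proof.
move=> ab tt La Pa Lb Pb; have [na nb] := path_within_source.
have [_ tl _] := cz.
split=> //.
- by rewrite /= inE ab.
- by rewrite /= La Lb tt.
- by move=> v w; rewrite !inE => /orP[]/eqP-> /orP[]/eqP->; rewrite ?La ?Lb; lra.
- by rewrite !inE !eqxx orbT La Lb.
- by move=> v; rewrite !inE => /orP[]/eqP->; rewrite ?La ?Lb.
- move=> v; rewrite !inE => /orP[]/eqP->; right; rewrite ?Pa ?Pb ?La ?Lb.
    exact: describes_swap.
  by rewrite subKr.
- move=> v; rewrite !inE => /orP[]/eqP->; rewrite ?La ?Lb /= ?eqxx ?(negbTE ab).
    lra.
  rewrite -[X in _ <= X]natr1; have : 0 <= 1%:R :> R by exact: ler0n.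
  lra.
Qed.

End Search.

(** Reversing the source edge reduces the case 1 - t < t to [search_start_edge]. *)
Lemma search_inv_swap (R : realType) n (e : rel 'I_n) a b t z qs L P h u rest :
  search_inv R n e b a (1 - t) z qs L P h u rest ->
  search_inv R n e a b t z qs L P h u rest.
Proof.
by case=> ? ? ? ? ? ? [? ? ?]; rewrite subKr => ? ? ? ?; split.
Qed.

(** * Points at a prescribed distance on the search tree *)

Section Locate.
Variables (R : realType) (n : nat) (e : rel 'I_n).
Hypothesis simple : simple_graph e.
Hypothesis conn : connected_graph e.
Local Notation X := (graph_point R e).
Variable d : X -> X -> R.
Hypothesis dE : d = @graph_dist R n e.

Let dP : pseudometric R X d.
Proof. by rewrite dE; apply: graph_pseudometric. Qed.

Let dle x y l : path_within x y l -> d x y <= l.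
Proof. by rewrite dE; apply: graph_dist_le. Qed.

Variables (a b : 'I_n) (t : R) (z : X) (L : 'I_n -> R) (P : 'I_n -> 'I_n).
Hypothesis tree : search_tree R n e a b t z L P.

Lemma tree_dist v : d z (vertex v) <= L v.
Proof. by have [[_ _ _ _ nearL] _] := tree; apply: dle. Qed.

Lemma tree_ge0 v : 0 <= L v.
Proof.
apply: le_trans (tree_dist v).
exact: pseudometric_ge0 dP _ _.
Qed.

Lemma tree_parent v : 1 < L v -> e (P v) v /\ L (P v) + 1 <= L v.
Proof. by have [_ /(_ v)[_ [//|[_ Lv _]]]] := tree; lra. Qed.

Lemma tree_parent_edge v : (P v == v) || e (P v) v.
Proof. by have [_ /(_ v)[_ [[->]|[]//]]] := tree; rewrite orbT. Qed.

(** The edge from [P v] to v covers the distances [L v - 1] to [L v], which fixes the parameter.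
    Upper bounds suffice, as [pseudometric_between] turns them into equalities on a geodesic. *)
Lemma tree_locate v r : 0 <= r -> L v - 1 <= r -> r <= L v ->
  exists c, [/\ @describes R n e (P v, v, r - L v + 1) c, d z c <= r &
    d c (vertex v) <= L v - r].
Proof.
move=> r0 r1 r2; have cell := tree_parent_edge v.
have [_ _ dT] := dP.
have [|c cc] := describes_ex R n e (r - L v + 1) cell; first by lra.
have cv : d c (vertex v) <= L v - r.
  apply: dle.
  apply: path_within_le (path_within_seg _ _ _ cc (describes_vertex1 R n e cell)) _.
  by rewrite ler_norml; lra.
exists c; split=> //.
have [_ /(_ v)[_ [[ePv LPv]|dz]]] := tree; last first.
  apply: dle; apply: path_within_le (path_within_seg _ _ _ dz cc) _.
  by rewrite ler_norml; lra.
have := dT z (vertex (P v)) c; have := tree_dist (P v).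
have : d (vertex (P v)) c <= r - L v + 1.
  apply: dle.
  apply: path_within_le (path_within_seg _ _ _ (describes_vertex0 R n e cell) cc) _.
  by rewrite ler_norml; lra.
lra.
Qed.

End Locate.

(** * The program *)

(* Word arrays: 7, 8 ends of the edge of the source; 9 stamp of the current
   search; 10 stamp of the last search that reached a vertex; 11 parents;
   12 queue; 13, 14 head and tail of the queue; 15 current vertex; 16, 17 the
   unread part of its adjacency list; 18 a neighbour; 20, 21 ends of the edge
   of the target; 22 scan index; 23 index of the best point so far; 24 a saved
   index; 25 walk towards the source; 26 temporary.
   Real arrays: 2 position of the source on its edge; 3 distances from the
   source; 4 values of the points of S; 5 position of the target on its edge;
   6 distance from source to target; 7 best value so far; 8 radius; 9 position
   of the target on the edge of the source; 10 temporary. *)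

Definition wvar (a : nat) : wexp := WGet a (WNat 0).
Definition rvar (a : nat) : rexp := RGet a (WNat 0).
Definition weq (x y : wexp) : bexp := BAnd (WLe x y) (WLe y x).
Definition rlt (x y : rexp) : bexp := BNot (RLe y x).
Definition wset (a : nat) (x : wexp) : cmd void := WSet a (WNat 0) x.
Definition rset (a : nat) (x : rexp) : cmd void := RSet a (WNat 0) x.

Definition load_cmd (j a b q : nat) : cmd void :=
  Seq (wset a (WGet 3 (wvar j)))
    (Seq (wset b (WGet 4 (wvar j)))
      (Seq (rset q (RGet 0 (wvar j)))
        (If (weq (wvar a) (wvar b)) (rset q (RNat 0)) Skip))).

Definition load0_cmd (a b q : nat) : cmd void :=
  Seq (wset a (WNat 0)) (Seq (wset b (WNat 0)) (rset q (RNat 0))).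

Definition push_cmd (v p : wexp) (x : rexp) : cmd void :=
  If (weq (WGet 10 v) (wvar 9)) Skip
    (Seq (WSet 10 v (wvar 9))
      (Seq (WSet 11 v p)
        (Seq (RSet 3 v x)
          (Seq (WSet 12 (wvar 14) v) (wset 14 (WAdd (wvar 14) (WNat 1))))))).

Definition search_cmd : cmd void :=
  let push_a := push_cmd (wvar 7) (wvar 8) (rvar 2) in
  let push_b := push_cmd (wvar 8) (wvar 7) (RSub (RNat 1) (rvar 2)) in
  Seq (Seq (wset 9 (WAdd (wvar 9) (WNat 1)))
    (Seq (wset 13 (WNat 0)) (Seq (wset 14 (WNat 0))
      (Seq (wset 16 (WNat 0)) (wset 17 (WNat 0))))))
  (Seq (If (RLe (rvar 2) (RSub (RNat 1) (rvar 2)))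
          (Seq push_a push_b) (Seq push_b push_a))
    (While (BNot (BAnd (WLe (wvar 17) (wvar 16)) (WLe (wvar 14) (wvar 13))))
      (If (WLe (wvar 17) (wvar 16))
        (Seq (wset 15 (WGet 12 (wvar 13)))
          (Seq (wset 13 (WAdd (wvar 13) (WNat 1)))
            (Seq (wset 16 (WGet 1 (wvar 15)))
              (wset 17 (WGet 1 (WAdd (wvar 15) (WNat 1)))))))
        (Seq (wset 18 (WGet 2 (wvar 16)))
          (Seq (wset 16 (WAdd (wvar 16) (WNat 1)))
            (push_cmd (wvar 18) (wvar 15)
              (RAdd (RGet 3 (wvar 15)) (RNat 1)))))))).

Definition orient_cmd : cmd void :=
  If (rlt (RAdd (RGet 3 (wvar 21)) (RSub (RNat 1) (rvar 5)))
          (RAdd (RGet 3 (wvar 20)) (rvar 5)))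
    (Seq (wset 26 (wvar 20)) (Seq (wset 20 (wvar 21))
      (Seq (wset 21 (wvar 26)) (rset 5 (RSub (RNat 1) (rvar 5))))))
    Skip.

Definition direct_cmd (q : rexp) : cmd void :=
  Seq (rset 10 (RSub (rvar 2) q))
    (Seq (If (RLe (rvar 10) (RNat 0)) (rset 10 (RSub (RNat 0) (rvar 10))) Skip)
      (If (rlt (rvar 10) (rvar 6)) (Seq (rset 6 (rvar 10)) (rset 9 q)) Skip)).

Definition dist_cmd : cmd void :=
  Seq orient_cmd
    (Seq (rset 6 (RAdd (RGet 3 (wvar 20)) (rvar 5)))
      (Seq (If (BAnd (weq (wvar 7) (wvar 20)) (weq (wvar 8) (wvar 21)))
              (direct_cmd (rvar 5)) Skip)
           (If (BAnd (weq (wvar 7) (wvar 21)) (weq (wvar 8) (wvar 20)))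
              (direct_cmd (RSub (RNat 1) (rvar 5))) Skip))).

Definition output_cmd (k : nat) (u v : wexp) (q : rexp) : cmd void :=
  Seq (WSet 5 (WNat k) u) (Seq (WSet 6 (WNat k) v) (RSet 1 (WNat k) q)).

Definition center_cmd (k : nat) : cmd void :=
  If (RLe (RAdd (RGet 3 (wvar 20)) (rvar 5)) (rvar 6))
    (If (RLe (rvar 8) (RGet 3 (wvar 20)))
      (Seq (wset 25 (wvar 20))
        (Seq (While (rlt (RAdd (rvar 8) (RNat 1)) (RGet 3 (wvar 25)))
               (wset 25 (WGet 11 (wvar 25))))
          (output_cmd k (WGet 11 (wvar 25)) (wvar 25)
            (RAdd (RSub (rvar 8) (RGet 3 (wvar 25))) (RNat 1)))))
      (output_cmd k (wvar 20) (wvar 21) (RSub (rvar 8) (RGet 3 (wvar 20)))))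
    (If (RLe (rvar 2) (rvar 9))
      (output_cmd k (wvar 7) (wvar 8) (RAdd (rvar 2) (rvar 8)))
      (output_cmd k (wvar 7) (wvar 8) (RSub (rvar 2) (rvar 8)))).

(* With acc = true, the distances to the current source are combined by
   minimum with the values already in real array 4. *)
Definition scan_cmd (acc : bool) : cmd void :=
  Seq (Seq (wset 22 (WNat 0)) (Seq (wset 23 (WNat 0)) (rset 7 (RNat 0))))
    (While (BNot (WLe (WGet 0 (WNat 1)) (wvar 22)))
      (Seq (load_cmd 22 20 21 5)
        (Seq dist_cmd
          (Seq (if acc then If (rlt (RGet 4 (wvar 22)) (rvar 6))
                              (rset 6 (RGet 4 (wvar 22))) Skip
                else Skip)
            (Seq (RSet 4 (wvar 22) (rvar 6))
              (Seq (If (RLe (rvar 7) (rvar 6))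
                      (Seq (rset 7 (rvar 6)) (wset 23 (wvar 22))) Skip)
                (wset 22 (WAdd (wvar 22) (WNat 1))))))))).

Definition sweep_cmd (acc : bool) : cmd void := Seq search_cmd (scan_cmd acc).

Definition place_cmd (k : nat) : cmd void := Seq dist_cmd (center_cmd k).

Definition graph_prog (p : nat) : cmd void :=
  let radius := rset 8 (RDiv (rvar 7) (RNat 2)) in
  let two_sweeps :=
    Seq (Seq (load0_cmd 7 8 2) (sweep_cmd false))
      (Seq (wset 24 (wvar 23)) (Seq (load_cmd 24 7 8 2) (sweep_cmd false))) in
  let place0 := Seq (load0_cmd 20 21 5) (place_cmd 0) in
  if p == 1%N then Seq two_sweeps (Seq radius place0)
  else
    Seq two_sweeps
      (Seq (Seq (load_cmd 23 7 8 2) (Seq (sweep_cmd true) radius))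
        (Seq (Seq (load_cmd 24 20 21 5) (place_cmd 1))
          (Seq (Seq (load_cmd 24 7 8 2) search_cmd) place0))).

(** * Total correctness with running time *)

Section Logic.
Variable (R : realType).
Local Notation st_t := (state R unit).
Implicit Types (st : st_t) (Q : st_t -> nat -> Prop).

Definition wp (c : cmd void) st Q : Prop :=
  exists st' t, exec (@no_step R) c st st' t /\ Q st' t.

Definition word_set st (a i v : nat) : st_t :=
  State (update (words st) a i v) (reals st) (points st).

Definition real_set st (a i : nat) (x : R) : st_t :=
  State (words st) (update (reals st) a i x) (points st).

Lemma wp_mono c st Q Q' : wp c st Q -> (forall st' t, Q st' t -> Q' st' t) -> wp c st Q'.
Proof. by case=> st' [t [ex q]] QQ; exists st', t; split=> //; apply: QQ. Qed.

Lemma wp_skip st Q : Q st 1%N -> wp Skip st Q.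
Proof. by move=> q; exists st, 1%N; split=> //; constructor. Qed.

Lemma wp_wset a i x st Q :
  Q (word_set st a (weval st i) (weval st x)) 1%N -> wp (WSet a i x) st Q.
Proof. by move=> q; eexists; exists 1%N; split; first exact: ExecWSet. Qed.

Lemma wp_rset a i x st Q :
  Q (real_set st a (weval st i) (reval st x)) 1%N -> wp (RSet a i x) st Q.
Proof. by move=> q; eexists; exists 1%N; split; first exact: ExecRSet. Qed.

Lemma wp_seq c1 c2 st Q :
  wp c1 st (fun st1 t1 => wp c2 st1 (fun st2 t2 => Q st2 (t1 + t2)%N)) ->
  wp (Seq c1 c2) st Q.
Proof.
case=> st1 [t1 [ex1 [st2 [t2 [ex2 q]]]]]; exists st2, (t1 + t2)%N; split=> //.
exact: ExecSeq ex1 ex2.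
Qed.

Lemma wp_if b c1 c2 st Q :
  wp (if beval st b then c1 else c2) st (fun st' t => Q st' t.+1) ->
  wp (If b c1 c2) st Q.
Proof. by case=> st' [t [ex q]]; exists st', t.+1; split=> //; apply: ExecIf. Qed.

(* In I k st, the number k bounds the time left. *)
Lemma wp_while b c (I : nat -> st_t -> Prop) k st Q :
  (forall k st, I k st -> beval st b ->
    wp c st (fun st' t => exists2 k', I k' st' & (t + 1 + k' <= k)%N)) ->
  (forall k' st' t, I k' st' -> ~~ beval st' b -> (t <= k + 1)%N -> Q st' t) ->
  I k st -> wp (While b c) st Q.
Proof.
move=> step fin Ik.
suff [st' [t [k' [ex Ik' nb tk]]]] : exists st' t k',
    [/\ exec (@no_step R) (While b c) st st' t, I k' st', ~~ beval st' b & (t <= k + 1)%N].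
  by exists st', t; split=> //; apply: fin Ik' nb tk.
move: {2}k.+1 (ltnSn k) => m; elim: m k st Ik {fin Q} => // m IH k st Ik km.
have [bst|nb] := boolP (beval st b); last first.
  by exists st, 1%N, k; split=> //; [exact: ExecWhileF | rewrite addn1].
have [st1 [t1 [ex1 [k1 Ik1 tk1]]]] := step _ _ Ik bst.
have [|st2 [t2 [k2 [ex2 Ik2 nb2 tk2]]]] := IH k1 st1 Ik1; first by lia.
exists st2, (t1 + t2).+1, k2; split=> //; last by lia.
exact: ExecWhileT bst ex1 ex2.
Qed.

Lemma beval_weq st x y : beval st (weq x y) = (weval st x == weval st y).
Proof. by rewrite /= -eqn_leq. Qed.

Lemma beval_rlt st x y : beval st (rlt x y) = (reval st x < reval st y).
Proof. by rewrite /= -ltNge. Qed.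

Definition frame (W V : seq nat) st st' : Prop :=
  (forall a j, a \notin W -> words st' a j = words st a j) /\
  (forall a j, a \notin V -> reals st' a j = reals st a j).

Lemma frame_refl W V st : frame W V st st. Proof. by []. Qed.

Lemma frame_word_set W V st st' a i v : a \in W ->
  frame W V st st' -> frame W V st (word_set st' a i v).
Proof.
move=> aW [fW fV]; split=> b j bN; last exact: fV.
by rewrite /= /update; case: eqP => [E|_] /=; [rewrite E aW in bN | exact: fW].
Qed.

Lemma frame_real_set W V st st' a i v : a \in V ->
  frame W V st st' -> frame W V st (real_set st' a i v).
Proof.
move=> aW [fW fV]; split=> b j bN; first exact: fW.
by rewrite /= /update; case: eqP => [E|_] /=; [rewrite E aW in bN | exact: fV].
Qed.

Lemma frame_trans W V st1 st2 st3 : frame W V st1 st2 -> frame W V st2 st3 ->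
  frame W V st1 st3.
Proof.
move=> [w12 v12] [w23 v23]; split=> a j aN; first by rewrite w23 // w12.
by rewrite v23 // v12.
Qed.

Lemma frame_sub W V W' V' st st' : frame W V st st' ->
  all (mem W') W -> all (mem V') V -> frame W' V' st st'.
Proof.
move=> [fW fV] /allP sW /allP sV; split=> a j aN; [apply: fW | apply: fV].
  by apply: contra aN => /sW.
by apply: contra aN => /sV.
Qed.

End Logic.

Ltac wp_step :=
  first [ apply: wp_seq | apply: wp_wset | apply: wp_rset | apply: wp_skip ].

Ltac frame_tac :=
  repeat (first [ apply: frame_word_set => // | apply: frame_real_set => // ]);
  try exact: frame_refl.

(** * Distances and centers *)

Arguments words {R P} _ (_ _)%_N.
Arguments reals {R P} _ (_ _)%_N.

Section Machine.
Variables (R : realType) (n : nat) (e : rel 'I_n).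
Hypothesis simple : simple_graph e.
Hypothesis conn : connected_graph e.
Local Notation X := (graph_point R e).
Variable d : X -> X -> R.
Hypothesis dE : d = @graph_dist R n e.
Local Notation st_t := (state R unit).
Local Notation wp := (@wp R).
Local Notation frame := (@frame R).
Implicit Types st : st_t.

Let dP : pseudometric R X d.
Proof. by rewrite dE; apply: graph_pseudometric. Qed.

Let dle x y l : path_within x y l -> d x y <= l.
Proof. by rewrite dE; apply: graph_dist_le. Qed.

Variables (adj : 'I_n -> seq 'I_n) (S : seq X) (descr : X -> 'I_n * 'I_n * R).
Hypothesis adjP : adjacency_lists e adj.
Hypothesis descrP : forall x, x \in S -> describes (descr x) x.
Variables (v0 : 'I_n).
Hypothesis v00 : v0 = 0%N :> nat.

(** Word arrays 0 to 4 and real array 0 hold the input; the two ranges cover every array that the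
    program writes. *)
Definition input_in st : Prop :=
  frame (iota 5 40) (iota 1 40) (graph_input adj (map descr S)) st.

Definition pnt i : X := nth (vertex v0) S i.

Definition point_in st (ku kv kt : nat) (x : X) : Prop :=
  exists u v : 'I_n, [/\ words st ku 0%N = u, words st kv 0%N = v,
    describes (u, v, reals st kt 0%N) x & u = v -> reals st kt 0%N = 0].

Lemma frame_input W V st st' : input_in st -> frame W V st st' ->
  all (mem (iota 5 40)) W -> all (mem (iota 1 40)) V -> input_in st'.
Proof. by move=> i f sW sV; apply: frame_trans i (frame_sub _ _ _ _ _ _ _ f sW sV). Qed.

(** Cells past the end of S read 0 and so describe vertex 0, the default of [pnt]. This spares the
    program a special case for empty S. *)
Lemma input_point st i : input_in st -> exists u v : 'I_n,
  [/\ words st 3 i = u, words st 4 i = v & describes (u, v, reals st 0%N i) (pnt i)].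
Proof.
move=> [fW fV]; rewrite !fW // fV //=.
have [iS|iS] := ltnP i (size S).
  have xS : pnt i \in S by apply: mem_nth.
  have := descrP _ xS; case E : (descr (pnt i)) => [[u v] t] cx.
  exists u, v; have nE T (x0 : T) f : nth x0 [seq f c | c <- [seq descr x | x <- S]] i = f (u, v, t).
    by rewrite (nth_map (u, v, t)) ?size_map // (nth_map (vertex v0)) // -/(pnt i) E.
  by rewrite !nE.
exists v0, v0; rewrite !nth_default ?size_map // v00 /pnt nth_default //.
by split=> //; apply: describes_vertex0; rewrite eqxx.
Qed.

Lemma load_spec st j ku kv kt : (ku, kv, kt) \in [:: (7, 8, 2); (20, 21, 5)]%N ->
  j \in [:: 22; 23; 24]%N -> input_in st ->
  wp (load_cmd j ku kv kt) st (fun st' t => [/\ (t <= 10)%N,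
    frame [:: ku; kv] [:: kt] st st' & point_in st' ku kv kt (pnt (words st j 0%N))]).
Proof.
move=> kP jP inp; have [u [v [wu wv cx]]] := input_point _ (words st j 0%N) inp.
have [t01 t01'] : 0 <= (0 : R) <= 1 /\ True by rewrite lexx ler01.
move: kP; rewrite !inE => /orP[]/eqP[-> -> ->];
  move: jP wu wv cx; rewrite !inE => /or3P[]/eqP-> wu wv cx;
  rewrite /load_cmd; do 3!(wp_step; wp_step); apply: wp_if; rewrite beval_weq /= /update /= wu wv;
  (have [uv|uv] := eqVneq (u : nat) v); wp_step; (split=> //; first by frame_tac);
  exists u, v; rewrite /= /update /= ?wu ?wv; split=> //; try (by apply: describes_same cx (val_inj uv) _ t01);
  by move=> uvE; rewrite uvE eqxx in uv.
Qed.

Lemma load0_spec st ku kv kt : (ku, kv, kt) \in [:: (7, 8, 2); (20, 21, 5)]%N ->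
  wp (load0_cmd ku kv kt) st (fun st' t => [/\ (t <= 10)%N,
    frame [:: ku; kv] [:: kt] st st' & point_in st' ku kv kt (vertex v0)]).
Proof.
rewrite !inE => /orP[]/eqP[-> -> ->]; rewrite /load0_cmd; do 2!(wp_step; wp_step); wp_step;
  (split=> //; first by frame_tac); exists v0, v0; rewrite /= /update /= v00;
  (split=> //; apply: describes_vertex0; by rewrite eqxx).
Qed.

Definition tree_in st (z : X) : Prop := exists (a b : 'I_n) L P,
  [/\ words st 7 0%N = a, words st 8 0%N = b, search_tree R n e a b (reals st 2 0%N) z L P,
      forall v : 'I_n, reals st 3 v = L v & forall v : 'I_n, words st 11 v = P v].

Lemma frame_tree W V st st' z : tree_in st z -> frame W V st st' ->
  [&& 7 \notin W, 8 \notin W, 11 \notin W, 2 \notin V & 3 \notin V]%N -> tree_in st' z.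
Proof.
move=> [a [b [L [P [wa wb tree rL wP]]]]] [fW fV] /and5P[? ? ? ? ?]; exists a, b, L, P.
by rewrite !fW // !fV //; split=> // v; rewrite ?fW ?fV.
Qed.

(** The distance alone is not enough to place a center: the disjunction records whether it is
    attained through the first end of the target edge or directly along the source edge. *)
Definition dist_in st (z y : X) : Prop :=
  [/\ point_in st 20 21 5 y, reals st 6 0%N = d z y &
    reals st 6 0%N = reals st 3 (words st 20 0%N) + reals st 5 0%N \/
    reals st 6 0%N < reals st 3 (words st 20 0%N) + reals st 5 0%N /\
    exists a b : 'I_n, [/\ words st 7 0%N = a, words st 8 0%N = b,
      describes (a, b, reals st 9 0%N) y &
      reals st 6 0%N = `|reals st 2 0%N - reals st 9 0%N|]].

Lemma orient_spec st y : point_in st 20 21 5 y ->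
  (forall v : 'I_n, words st 20 0%N = v -> 0 <= reals st 3 v) ->
  wp orient_cmd st (fun st' t => [/\ (t <= 6)%N, frame [:: 20; 21; 26]%N [:: 5]%N st st',
    point_in st' 20 21 5 y &
    reals st' 3 (words st' 20 0%N) + reals st' 5 0%N <=
    reals st' 3 (words st' 21 0%N) + (1 - reals st' 5 0%N)]).
Proof.
move=> py L0; have [u [v [wu wv cy uv0]]] := py.
have [_ tl _] := cy.
apply: wp_if; rewrite beval_rlt /=; case: ltP => le; last by wp_step.
do 3!(wp_step; wp_step); wp_step; split=> //; first by frame_tac.
  exists v, u; rewrite /= /update /= wu wv; split=> //.
    exact: describes_swap.
  (* Equal ends have q = 0, and then the strict test that led to this swap would read L + 1 < L. *)
  by move=> vu; rewrite wu wv vu (uv0 (esym vu)) in le; lra.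
by rewrite /= /update /=; lra.
Qed.

Lemma direct_spec st (q : rexp) x :
  (forall st', reals st' 5 0%N = reals st 5 0%N -> reval st' q = x) ->
  wp (direct_cmd q) st (fun st' t => [/\ (t <= 9)%N, frame [::] [:: 6; 9; 10]%N st st',
    reals st' 6 0%N = Num.min (reals st 6 0%N) `|reals st 2 0%N - x| &
    reals st' 9 0%N =
      if `|reals st 2 0%N - x| < reals st 6 0%N then x else reals st 9 0%N]).
Proof.
move=> qx; set D := `|_|.
rewrite /direct_cmd; do 2!wp_step; wp_step; rewrite /= qx //.
set st1 := real_set _ _ _ _ _.
have abs : wp (If (RLe (rvar 10) (RNat 0)) (rset 10 (RSub (RNat 0) (rvar 10))) Skip) st1
    (fun st2 t => [/\ (t <= 2)%N, frame [::] [:: 10]%N st st2 & reals st2 10 0%N = D]).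
  apply: wp_if; rewrite /= /update /=; case: leP => le; wp_step; (split=> //; first by frame_tac).
    by rewrite /= /update /= sub0r /D ler0_norm.
  by rewrite /= /update /= /D gtr0_norm.
apply: wp_mono abs _ => st2 t [t2 f E]; apply: wp_if; rewrite beval_rlt /= E.
have f6 : reals st2 6 0%N = reals st 6 0%N by case: f => _ ->.
have f' : frame [::] [:: 6; 9; 10]%N st st2 by apply: frame_sub f _ _.
rewrite f6; case: ltP => le.
  do 3!wp_step; rewrite /= E qx //=; last by rewrite /update /=; case: f => _ ->.
  by split; [lia | frame_tac | rewrite /update | rewrite /update].
wp_step; split=> //; first by lia.
by case: f => _ ->.
Qed.

Lemma dist_spec st z y : tree_in st z -> point_in st 20 21 5 y ->
  wp dist_cmd st (fun st' t => [/\ (t <= 40)%N,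
    frame [:: 20; 21; 26]%N [:: 5; 6; 9; 10]%N st st' & dist_in st' z y]).
Proof.
move=> tz py; rewrite /dist_cmd; wp_step.
have L0 (v : 'I_n) : words st 20 0%N = v -> 0 <= reals st 3 v.
  by have [a [b [L [P [_ _ tree -> _]]]]] := tz => _; apply: tree_ge0 simple conn d dE _ _ _ _ _ _ tree _.
apply: wp_mono (orient_spec _ _ py L0) _ => st1 t1 [t1l f1 p1 le1].
have {}tz := frame_tree _ _ _ _ _ tz f1 isT.
have {}f1 : frame [:: 20; 21; 26]%N [:: 5; 6; 9; 10]%N st st1 by apply: frame_sub f1 _ _.
have [u [v [wu wv cy uv0]]] := p1; have [a [b [L [P [wa wb tree rL wP]]]]] := tz.
rewrite wu wv !rL in le1.
set q := reals st1 5 0%N in cy uv0 le1; set t := reals st1 2 0%N in tree.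
have [labels _] := tree.
have zyE : d z y = label_dist a b t L u v q by rewrite dE; apply: graph_dist_labels labels cy uv0.
do 2!wp_step; rewrite /= wu rL -/q; set st2 := real_set _ _ _ _ _.
(* D0, D1, D2 are the successive contents of real cell 6. After orientation the route through u is
   no longer than the one through v, so D2 is [label_dist]. *)
pose D0 := L u + q; pose D1 := if (a == u) && (b == v) then Num.min D0 `|t - q| else D0.
pose D2 := if (a == v) && (b == u) then Num.min D1 `|t - (1 - q)| else D1.
have D2E : D2 = d z y by rewrite zyE /label_dist (min_l le1).
have D10 : D1 <= D0 by rewrite /D1; case: ifP => // _; rewrite ge_min lexx.
have D21 : D2 <= D1 by rewrite /D2; case: ifP => // _; rewrite ge_min lexx.
have [_ ql _] := cy.
have f2 : frame [:: 20; 21; 26]%N [:: 5; 6; 9; 10]%N st st2 by frame_tac.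
have first : wp (If (BAnd (weq (wvar 7) (wvar 20)) (weq (wvar 8) (wvar 21)))
    (direct_cmd (rvar 5)) Skip) st2 (fun st3 t => [/\ (t <= 10)%N,
      frame [::] [:: 6; 9; 10]%N st2 st3, reals st3 6 0%N = D1 &
      D1 < D0 -> describes (a, b, reals st3 9 0%N) y /\ D1 = `|reals st1 2 0%N - reals st3 9 0%N|]).
  apply: wp_if; rewrite [beval _ _]/= -!eqn_leq /= wa wb wu wv.
  have -> : (nat_of_ord a == u) && (nat_of_ord b == v) = (a == u) && (b == v) by [].
  rewrite /D1; case: ifP => [/andP[/eqP au /eqP bv]|_].
    apply: wp_mono (direct_spec st2 (rvar 5) q _) _ => [//|st3 t3 [t3l f3 E Eq]].
    have rD : reals st2 6 0%N = D0 by [].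
    have r2 : reals st2 2 0%N = t by [].
    rewrite rD r2 in E Eq; split=> // lt.
    move: lt Eq; case: (leP D0 `|t - q|) => [|_ _ ->]; first by rewrite ltxx.
    by rewrite au bv; split.
  by wp_step; split=> //; rewrite ltxx.
wp_step; apply: wp_mono first _ => st3 t3 [t3l f3 E3 G3].
have [F3w F3v] := f3.
have second : wp (If (BAnd (weq (wvar 7) (wvar 21)) (weq (wvar 8) (wvar 20)))
    (direct_cmd (RSub (RNat 1) (rvar 5))) Skip) st3 (fun st4 t => [/\ (t <= 10)%N,
      frame [::] [:: 6; 9; 10]%N st3 st4, reals st4 6 0%N = D2 &
      D2 < D0 -> describes (a, b, reals st4 9 0%N) y /\ D2 = `|reals st1 2 0%N - reals st4 9 0%N|]).
  apply: wp_if; rewrite [beval _ _]/= -!eqn_leq /= !F3w //= wa wb wu wv.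
  have -> : (nat_of_ord a == v) && (nat_of_ord b == u) = (a == v) && (b == u) by [].
  rewrite /D2; case: ifP => [/andP[/eqP av /eqP bu]|_]; last first.
    by wp_step; split.
  apply: wp_mono (direct_spec st3 (RSub (RNat 1) (rvar 5)) (1 - q) _) _.
    by move=> st' /=; rewrite F3v // => ->.
  move=> st4 t4 [t4l f4 E Eq]; have r2 : reals st3 2 0%N = t by rewrite F3v.
  rewrite E3 r2 in E Eq; split=> // lt.
  move: lt Eq; case: (leP D1 `|t - (1 - q)|) => [le D10' ->|lt1 _ ->]; first exact: G3.
  by rewrite av bu; split=> //; apply: describes_swap.
apply: wp_mono second _ => st4 t4 [t4l f4 E4 G4].
have f24 : frame [::] [:: 5; 6; 9; 10]%N st2 st4.
  by apply: frame_trans (frame_sub _ _ _ _ _ _ _ f3 _ _) (frame_sub _ _ _ _ _ _ _ f4 _ _).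
split; first by lia.
  by apply: frame_trans f2 (frame_sub _ _ _ _ _ _ _ f24 _ _).
have [F4w F4v] := f4.
have E (k : nat) : k \notin [:: 6; 9; 10]%N -> reals st4 k 0%N = reals st2 k 0%N.
  by move=> kN; rewrite F4v // F3v.
have Ew (k : nat) j : words st4 k j = words st1 k j by rewrite F4w // F3w.
split.
- by exists u, v; rewrite !Ew E.
- by rewrite E4 D2E.
- rewrite E4 Ew wu (E 5%N) //; have -> : reals st4 3 u = L u by rewrite F4v // F3v //; apply: rL.
  have -> : reals st2 5 0%N = q by [].
  have := le_trans D21 D10; rewrite le_eqVlt => /orP[/eqP->|lt]; first by left.
  right; split=> //; exists a, b; rewrite !Ew; have [cG DG] := G4 lt.
  by split=> //; rewrite (E 2%N).
Qed.

Definition output_in st k (c : X) : Prop := exists u v : 'I_n,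
  [/\ words st 5 k = u, words st 6 k = v & describes (u, v, reals st 1 k) c].

Definition same_outputs st st' k : Prop := forall j, j != k ->
  [/\ words st' 5 j = words st 5 j, words st' 6 j = words st 6 j &
      reals st' 1 j = reals st 1 j].

Lemma output_spec st k (ue ve : wexp) (xe : rexp) (u v : 'I_n) x c :
  (forall st', frame [:: 5; 6]%N [::] st st' ->
    [/\ weval st' ue = u, weval st' ve = v & reval st' xe = x]) ->
  describes (u, v, x) c ->
  wp (output_cmd k ue ve xe) st (fun st' t => [/\ (t <= 5)%N,
    frame [:: 5; 6]%N [:: 1]%N st st', same_outputs st st' k & output_in st' k c]).
Proof.
move=> ev cx; rewrite /output_cmd; do 2!(wp_step; wp_step); wp_step.
have [-> _ _] : [/\ weval st ue = u, weval st ve = v & reval st xe = x] by apply: ev.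
set st1 := word_set R st _ _ _.
have [_ -> _] : [/\ weval st1 ue = u, weval st1 ve = v & reval st1 xe = x].
  by apply: ev; frame_tac.
set st2 := word_set R st1 _ _ _.
have [_ _ ->] : [/\ weval st2 ue = u, weval st2 ve = v & reval st2 xe = x].
  by apply: ev; frame_tac.
split=> //; first by frame_tac.
  by move=> j /negbTE jk; rewrite /= /update /= jk.
by exists u, v; rewrite /= /update /= eqxx.
Qed.

Lemma between z c y r : d z c <= r -> d c y <= d z y - r ->
  d z c = r /\ d z c + d c y = d z y.
Proof. exact: pseudometric_between dP _ _ _ _. Qed.

(** Three positions are possible: on the source edge if the direct route is shortest, on the last
    segment from u to y if r exceeds [L u], and otherwise on the tree path from z to u, found by
    walking from u towards z. *)
Lemma center_spec st z y k : tree_in st z -> dist_in st z y ->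
  0 <= reals st 8 0%N <= reals st 6 0%N ->
  wp (center_cmd k) st (fun st' t => [/\ (t <= 2 * n + 20)%N,
    frame [:: 5; 6; 25]%N [:: 1]%N st st', same_outputs st st' k &
    exists c, [/\ output_in st' k c, d z c = reals st 8 0%N & d z c + d c y = d z y]]).
Proof.
have time_le t s : (t <= 2 * n + 1 -> s <= 5 -> (1 + (t + s)).+2 <= 2 * n + 20)%N.
  by clear; lia.
move=> tz [[u [v [wu wv cy uv0]]] DE cases] rD.
have [a [b [L [P [wa wb tree rL wP]]]]] := tz.
have [_ dC dT] := dP.
set r := reals st 8 0%N in rD *; set q := reals st 5 0%N in cy uv0 cases.
rewrite DE wu rL in cases rD.
have fin c st' t : frame [:: 5; 6]%N [:: 1]%N st st' -> same_outputs st st' k ->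
    output_in st' k c -> (t <= 5)%N -> d z c <= r -> d c y <= d z y - r ->
    [/\ (t.+2 <= 2 * n + 20)%N, frame [:: 5; 6; 25]%N [:: 1]%N st st', same_outputs st st' k &
    exists c, [/\ output_in st' k c, d z c = r & d z c + d c y = d z y]].
  move=> f so oc tl zc cy'; have [e1 e2] := between _ _ _ _ zc cy'; split=> //.
  - by lia.
  - by apply: frame_sub f _ _.
  - by exists c.
have [uv ql _] := cy; have [[cz _ _ _ _] _] := tree; have [_ tl _] := cz.
have vy : d (vertex u) y <= q.
  apply: dle.
  apply: path_within_le (path_within_seg _ _ _ (describes_vertex0 R n e uv) cy) _.
  by rewrite ler_norml; lra.
apply: wp_if; rewrite /= wu rL -/q DE; case: leP => [le|lt]; last first.
  case: cases => [eq|[_ [a' [b' [wa' wb' cy' D']]]]]; first by rewrite eq ltxx in lt.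
  have aa : a' = a by apply: val_inj; rewrite /= -wa -wa'.
  have bb : b' = b by apply: val_inj; rewrite /= -wb -wb'.
  rewrite aa bb in cy'; set G := reals st 9 0%N in cy' D'.
  set t := reals st 2 0%N in tree cz D' tl.
  have [cell Gl _] := cy'.
  have on_edge x : 0 <= x <= 1 -> `|t - x| <= r -> `|x - G| <= d z y - r ->
    exists c, [/\ describes (a, b, x) c, d z c <= r & d c y <= d z y - r].
    move=> xl tx xG; have [c cc] := describes_ex R n e x cell xl; exists c; split=> //.
      by apply: dle; apply: path_within_le (path_within_seg _ _ _ cz cc) tx.
    by apply: dle; apply: path_within_le (path_within_seg _ _ _ cc cy') xG.
  apply: wp_if => /=; rewrite -/t -/G; case: leP => tG.
    rewrite distrC ger0_norm ?subr_ge0 // in D'.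
    have [c [cc zc cyr]] : exists c, [/\ describes (a, b, t + r) c, d z c <= r & d c y <= d z y - r].
      by apply: on_edge; rewrite ?ler_norml; lra.
    apply: wp_mono (output_spec st k _ _ _ a b (t + r) c _ cc) _.
      by move=> st' [fW fV]; rewrite /= !fW // !fV.
    by move=> st' s [sl f so oc]; apply: fin f so oc sl zc cyr.
  rewrite gtr0_norm ?subr_gt0 // in D'.
  have [c [cc zc cyr]] : exists c, [/\ describes (a, b, t - r) c, d z c <= r & d c y <= d z y - r].
      by apply: on_edge; rewrite ?ler_norml; lra.
  apply: wp_mono (output_spec st k _ _ _ a b (t - r) c _ cc) _.
    by move=> st' [fW fV]; rewrite /= !fW // !fV.
  by move=> st' s [sl f so oc]; apply: fin f so oc sl zc cyr.
have {cases le}T : d z y = L u + q by case: cases => // -[lt _]; lra.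
apply: wp_if => /=; rewrite wu rL -/r; case: leP => [ru|ru]; last first.
  have [|c cc] := describes_ex R n e (r - L u) uv; first by lra.
  have zc : d z c <= r.
    have zu := tree_dist R n e simple conn d dE _ _ _ _ _ _ tree u.
    apply: (pseudometric_le _ _ _ dP z (vertex u) c (L u) (r - L u)) => //; last by rewrite addrC subrK.
    apply: dle.
    apply: path_within_le (path_within_seg _ _ _ (describes_vertex0 R n e uv) cc) _.
    by rewrite ler_norml; lra.
  have cyr : d c y <= d z y - r.
    apply: dle; apply: path_within_le (path_within_seg _ _ _ cc cy) _.
    by rewrite ler_norml; lra.
  apply: wp_mono (output_spec st k _ _ _ u v (r - L u) c _ cc) _.
    by move=> st' [fW fV]; rewrite /= !fW // !fV // wu rL.
  by move=> st' s [sl f so oc]; apply: fin f so oc sl zc cyr.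
wp_step; wp_step; rewrite /= wu; wp_step.
(* A parent step lowers the label by at least 1 and costs 2, so i bounds the remaining steps. The
   bound r <= L w survives because labels differ by at most 1 along an edge; the last clause keeps w
   on a geodesic to y. *)
pose I (m : nat) st1 := frame [:: 25]%N [::] st st1 /\ exists w : 'I_n, exists i : nat,
  [/\ words st1 25 0%N = w, m = (2 * i)%N, L w <= i%:R, r <= L w & d (vertex w) y <= d z y - L w].
apply: (wp_while R _ _ I (2 * n)%N).
- move=> m st1 [f1 [w [i [ww mi Li rw wy]]]]; rewrite beval_rlt /=.
  have [f1w f1v] := f1; rewrite !f1v // ww rL -/r => lt.
  wp_step; rewrite /= ww f1w // wP.
  have L1 : 1 < L w by lra.
  have [ePw LPw] := tree_parent R n e _ _ _ _ _ _ tree _ L1.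
  have [[_ _ _ lip _] _] := tree; have lipP := lip _ _ ePw.
  case: i mi Li => [|i] mi Li; first by have := lt_trans ltr01 L1; rewrite ltNge Li.
  have im : (1 + 1 + 2 * i <= m)%N by rewrite mi mulnS.
  exists (2 * i)%N => // {mi im}; split; first by frame_tac.
  exists (P w), i; split=> //; first by rewrite -natr1 in Li; lra.
    by lra.
  have cell : (P w == w) || e (P w) w by rewrite ePw orbT.
  apply: (pseudometric_le _ _ _ dP _ (vertex w) _ 1 (d z y - L w)) => //; last by lra.
  apply: dle; apply: path_within_le (path_within_seg _ _ _
    (describes_vertex0 R n e cell) (describes_vertex1 R n e cell)) _.
  by rewrite ler_norml; lra.
- move=> m st1 t1 [f1 [w [i [ww mi Li rw wy]]]]; rewrite beval_rlt /=.
  have [f1w f1v] := f1; rewrite !f1v // ww rL -/r -leNgt => le t1l.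
  have r0 : 0 <= r by case/andP: rD.
  have Lr : L w - 1 <= r by lra.
  have [c [cc zc cw]] := tree_locate R n e simple conn d dE _ _ _ _ _ _ tree w r r0 Lr rw.
  have cyr : d c y <= d z y - r by apply: (pseudometric_le _ _ _ dP _ (vertex w) _ _ _ _ cw wy); lra.
  apply: wp_mono (output_spec st1 k _ _ _ (P w) w (r - L w + 1) c _ cc) _.
    by move=> st' [fW fV]; rewrite /= !fW // !fV // ww !f1v // f1w // wP rL.
  move=> st' s [sl f so oc]; have [e1 e2] := between _ _ _ _ zc cyr; split=> //.
  + exact: time_le.
  + by apply: (frame_trans _ _ _ _ st1); [apply: frame_sub f1 _ _ | apply: frame_sub f _ _].
  + by move=> j jk; have [-> -> ->] := so _ jk; rewrite !f1w // f1v.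
  + by exists c.
- split; first by frame_tac.
  exists u, n; split=> //; first by have [_ /(_ u)[]] := tree.
  by rewrite T; lra.
Qed.

End Machine.

(** * The search loop *)

Lemma take_enum_ord n (v : nat) : (v <= n)%N ->
  take v (enum 'I_n) = [seq w : 'I_n <- enum 'I_n | (w < v)%N].
Proof.
move=> vn; apply: (inj_map val_inj); rewrite map_take val_enum_ord take_iota.
rewrite (minn_idPl vn) -(filter_map (@nat_of_ord n) (fun w => (w < v)%N)) val_enum_ord.
exact: esym (filter_iota_ltn 0 vn).
Qed.

Lemma nth_flatten_enum n (s : 'I_n -> seq nat) (v : 'I_n) i : (i < size (s v))%N ->
  nth 0%N (flatten [seq s u | u <- enum 'I_n])
    (\sum_(w < n | (w < v)%N) size (s w) + i) = nth 0%N (s v) i.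
Proof.
move=> iv; have vn := ltn_ord v.
have vE : nth v (enum 'I_n) v = v by apply: val_inj; rewrite /= nth_enum_ord.
rewrite -{1}(cat_take_drop v (enum 'I_n)) (drop_nth v) ?size_enum_ord // vE.
rewrite map_cat flatten_cat /= nth_cat.
have -> : size (flatten [seq s u | u <- take v (enum 'I_n)]) =
    (\sum_(w < n | (w < v)%N) size (s w))%N.
  rewrite size_flatten /shape -map_comp sumnE big_map take_enum_ord ?(ltnW vn) //.
  by rewrite big_filter big_enum_cond; apply: eq_bigl.
by rewrite ltnNge leq_addr /= addKn nth_cat iv.
Qed.

Section SearchProgram.
Variables (R : realType) (n : nat) (e : rel 'I_n).
Hypothesis simple : simple_graph e.
Hypothesis conn : connected_graph e.
Local Notation X := (graph_point R e).
Local Notation st_t := (state R unit).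
Local Notation wp := (@wp R).
Local Notation frame := (@frame R).
Implicit Types st : st_t.
Variables (adj : 'I_n -> seq 'I_n) (S : seq X) (descr : X -> 'I_n * 'I_n * R).
Hypothesis adjP : adjacency_lists e adj.
Variables (v0 : 'I_n).
Local Notation input_in := (input_in R n e adj S descr).

Lemma input_offset st (v : 'I_n) : input_in st ->
  words st 1 v.+1 = (words st 1 v + size (adj v))%N.
Proof.
move=> [fW _]; rewrite !fW //= ltn_ord ltnW //.
rewrite (bigD1 v) //= addnC; congr (_ + _)%N; apply: eq_bigl => w.
by rewrite ltnS andbC (ltn_neqAle w v).
Qed.

Lemma input_neighbour st (v : 'I_n) i : input_in st -> (i < size (adj v))%N ->
  words st 2 (words st 1 v + i) = nth v0 (adj v) i.
Proof.
move=> [fW _] iv; rewrite !fW //= ltnW //.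
have := nth_flatten_enum n (fun u => map (@nat_of_ord n) (adj u)) v i.
rewrite size_map => /(_ iv); rewrite (nth_map v0) // => <-.
by congr (nth _ _ (_ + _)%N); apply: eq_bigr => w _; rewrite size_map.
Qed.

(** A vertex is in the queue exactly when it bears the current stamp; this avoids clearing arrays
    between searches. *)
Definition queue_in st (qs : seq 'I_n) (L : 'I_n -> R) (P : 'I_n -> 'I_n) : Prop :=
  [/\ words st 14 0%N = size qs,
      forall i, (i < size qs)%N -> words st 12 i = nth v0 qs i,
      forall v : 'I_n, (words st 10 v == words st 9 0%N) = (v \in qs),
      forall v, v \in qs -> reals st 3 v = L v &
      forall v, v \in qs -> words st 11 v = P v].

(** The expressions are evaluated again after each write, so their values must survive the earlier
    ones. The label [xe] may read real array 3, which is written only after its evaluation. *)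
Lemma push_spec st ve pe xe (v p : 'I_n) x qs L P :
  (forall st', frame [:: 10; 11; 12]%N [:: 3]%N st st' ->
    weval st' ve = v /\ weval st' pe = p) ->
  (forall st', frame [:: 10; 11]%N [::] st st' -> reval st' xe = x) ->
  queue_in st qs L P ->
  wp (push_cmd ve pe xe) st (fun st' t => [/\ (t <= 8)%N,
    frame [:: 10; 11; 12; 14]%N [:: 3]%N st st' &
    if v \in qs then queue_in st' qs L P
    else queue_in st' (rcons qs v) (set_at n _ L v x) (set_at n _ P v p)]).
Proof.
move=> ev ex q; have [q1 q2 q3 q4 q5] := q.
have [ve0 _] : weval st ve = v /\ weval st pe = p by apply: ev.
apply: wp_if; rewrite beval_weq /= ve0 q3.
case: ifP => vq; first by wp_step.
do 2!wp_step; rewrite ve0 [weval st _]/=.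
set st1 := word_set R st _ _ _.
have [ve1 pe1] : weval st1 ve = v /\ weval st1 pe = p by apply: ev; frame_tac.
do 2!wp_step; rewrite ve1 pe1; set st2 := word_set R st1 _ _ _.
have [ve2 _] : weval st2 ve = v /\ weval st2 pe = p by apply: ev; frame_tac.
have xe2 : reval st2 xe = x by apply: ex; frame_tac.
do 2!wp_step; rewrite ve2 xe2; set st3 := real_set R st2 _ _ _.
have [ve3 _] : weval st3 ve = v /\ weval st3 pe = p by apply: ev; frame_tac.
do 2!wp_step; rewrite ve3; wp_step; split=> //; first by frame_tac.
have neq w : w \in qs -> (w == v) = false by move=> wq; apply: contraFF vq => /eqP<-.
rewrite /set_at; split.
- by rewrite size_rcons /= /update /= q1 addn1.
- move=> i; rewrite size_rcons ltnS /= /update /= q1 nth_rcons => iq.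
  by case: ltngtP iq => // iq _; rewrite q2.
- move=> w; rewrite /= /update /= mem_rcons inE val_eqE.
  by case: (w == v) => //=; rewrite ?eqxx.
- move=> w; rewrite mem_rcons inE /= /update /= val_eqE; case: eqP => //= _ wq.
  exact: q4.
- move=> w; rewrite mem_rcons inE /= /update /= val_eqE; case: eqP => //= _ wq.
  exact: q5.
Qed.

Definition adjacency_weight (A : pred 'I_n) : nat :=
  (\sum_(v | A v) (size (adj v)).+1)%N.

Lemma adjacency_weight_take qs h (u : 'I_n) : uniq qs -> (h < size qs)%N ->
  nth u qs h = u ->
  adjacency_weight [predC take h qs] =
  ((size (adj u)).+1 + adjacency_weight [predC take h.+1 qs])%N.
Proof.
move=> uq hq hu; have uh : u \notin take h qs.
  move: uq; rewrite -{1}(cat_take_drop h.+1 qs) cat_uniq (take_nth u) // hu rcons_uniq.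
  by case/andP=> /andP[-> _].
rewrite /adjacency_weight (bigD1 u) //=; congr (_ + _)%N; apply: eq_bigl => v.
by rewrite /= (take_nth u) // hu mem_rcons inE negb_or andbC.
Qed.

(** Amortised cost: 12 units for each vertex not yet dequeued, for each entry of its list, and for
    each unread entry of the current list. An iteration costs at most two tests, two assignments and
    a push of 8. *)
Definition search_loop_inv st0 (a b : 'I_n) (t : R) (z : X) (k : nat) st : Prop :=
  exists qs L P h u rest,
  [/\ frame [:: 10; 11; 12; 13; 14; 15; 16; 17; 18]%N [:: 3]%N st0 st /\ queue_in st qs L P,
      search_inv R n e a b t z qs L P h u rest,
      words st 13 0%N = h /\ (rest != [::] -> words st 15 0%N = u),
      words st 17 0%N = (words st 16 0%N + size rest)%N /\
      (forall i, (i < size rest)%N -> words st 2 (words st 16 0%N + i) = nth v0 rest i) &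
      k = (12 * (size rest + adjacency_weight [predC take h qs]))%N].

Lemma search_advance_spec st0 a b t z qs L P h u k st : input_in st ->
  [/\ frame [:: 10; 11; 12; 13; 14; 15; 16; 17; 18]%N [:: 3]%N st0 st /\ queue_in st qs L P,
      search_inv R n e a b t z qs L P h u [::], words st 13 0%N = h, (h < size qs)%N &
      k = (12 * adjacency_weight [predC take h qs])%N] ->
  wp (Seq (wset 15 (WGet 12 (wvar 13)))
       (Seq (wset 13 (WAdd (wvar 13) (WNat 1)))
         (Seq (wset 16 (WGet 1 (wvar 15)))
           (wset 17 (WGet 1 (WAdd (wvar 15) (WNat 1))))))) st
    (fun st' s => exists2 k', search_loop_inv st0 a b t z k' st' & (s.+2 + k' <= k)%N).
Proof.
move=> inp [[f q] I hd hq ->]; have [q1 q2 q3 q4 q5] := q.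
have qh := q2 _ hq; set u' := nth v0 qs h in qh.
have u'h : nth u' qs h = u' by apply: set_nth_default.
do 3!(wp_step; wp_step); wp_step; rewrite /= /update /= hd qh !addn1.
have off := input_offset st u' inp.
exists (12 * (size (adj u') + adjacency_weight [predC take h.+1 qs]))%N; last first.
  rewrite (adjacency_weight_take _ _ _ (inv_uniq _ _ _ _ _ _ _ _ _ _ _ _ _ I) hq u'h).
  by set A := adjacency_weight _; lia.
exists qs, L, P, h.+1, u', (adj u'); split=> //.
- by split=> //; apply: frame_trans f _; frame_tac.
- by apply: search_advance I hq u'h _; case: (adjP u').
- by rewrite /update /= off; split=> // i iA; apply: input_neighbour.
Qed.

Lemma search_loop_spec a b t z qs L P u st : input_in st ->
  @describes R n e (a, b, t) z -> (a = b -> t = 0) ->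
  queue_in st qs L P -> search_inv R n e a b t z qs L P 0 u [::] ->
  words st 13 0%N = 0%N -> words st 16 0%N = 0%N -> words st 17 0%N = 0%N ->
  wp (While (BNot (BAnd (WLe (wvar 17) (wvar 16)) (WLe (wvar 14) (wvar 13))))
      (If (WLe (wvar 17) (wvar 16))
        (Seq (wset 15 (WGet 12 (wvar 13)))
          (Seq (wset 13 (WAdd (wvar 13) (WNat 1)))
            (Seq (wset 16 (WGet 1 (wvar 15)))
              (wset 17 (WGet 1 (WAdd (wvar 15) (WNat 1)))))))
        (Seq (wset 18 (WGet 2 (wvar 16)))
          (Seq (wset 16 (WAdd (wvar 16) (WNat 1)))
            (push_cmd (wvar 18) (wvar 15)
              (RAdd (RGet 3 (wvar 15)) (RNat 1))))))) st
    (fun st' s => [/\ (s <= 12 * adjacency_weight predT + 1)%N,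
      frame [:: 10; 11; 12; 13; 14; 15; 16; 17; 18]%N [:: 3]%N st st' &
      exists qs L P, [/\ queue_in st' qs L P, forall v, v \in qs & search_tree R n e a b t z L P]]).
Proof.
move=> inp cz norm_z q I hd p16 p17.
apply: (wp_while R _ _ (search_loop_inv st a b t z) (12 * adjacency_weight predT)%N).
- move=> k st1 [qs1 [L1 [P1 [h [v [rest [[f q'] I' [hd' ru] [p17' nb] ->]]]]]]] /=.
  have inp1 : input_in st1 by apply: frame_input inp f _ _.
  have [q1 q2 q3 q4 q5] := q'.
  rewrite hd' q1 p17' => guard; apply: wp_if; rewrite /= p17'.
  case: rest guard I' ru p17' nb => [|w rest] guard I' ru p17' nb.
    rewrite addn0 leqnn; rewrite addn0 leqnn /= -ltnNge in guard.
    apply: wp_mono (search_advance_spec st a b t z qs1 L1 P1 h v _ st1 inp1 _) _; first by split.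
    by move=> st2 s [k' I2 le]; exists k' => //; rewrite addn1 add0n.
  rewrite leqNgt /= addnS ltnS leq_addr /=.
  have [uq subr _ _] := inv_cur _ _ _ _ _ _ _ _ _ _ _ _ _ I' isT.
  have w2 : words st1 2 (words st1 16 0%N) = w by have := nb 0%N isT; rewrite addn0.
  have ru' := ru isT.
  do 2!(wp_step; wp_step); rewrite /= /update /= w2.
  set st2 := word_set R _ _ _ _.
  have q2' : queue_in st2 qs1 L1 P1 by [].
  have f2 : frame [:: 16; 18]%N [::] st1 st2 by frame_tac.
  apply: wp_mono (push_spec st2 (wvar 18) (wvar 15) _ w v (L1 v + 1) qs1 L1 P1 _ _ q2') _.
  + by move=> st' [fW _] /=; rewrite !fW // /st2 /= /update /= ru'.
  + by move=> st' [fW fV] /=; rewrite fW // fV // /st2 /= /update /= ru' q4.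
  move=> st3 s [sl f3 q3']; have [F3w F3v] := f3.
  exists (12 * (size rest + adjacency_weight [predC take h qs1]))%N; last first.
    by rewrite /= mulnDr mulnDr mulnS; lia.
  have f13 : frame [:: 10; 11; 12; 13; 14; 15; 16; 17; 18]%N [:: 3]%N st st3.
    apply: frame_trans f _; apply: (frame_trans _ _ _ _ st2).
      by apply: frame_sub f2 _ _.
    by apply: frame_sub f3 _ _.
  have e13 : words st3 13 0%N = h by rewrite F3w.
  have e15 : words st3 15 0%N = v by rewrite F3w.
  have e16 : words st3 16 0%N = (words st1 16 0%N + 1)%N by rewrite F3w.
  have e17 : words st3 17 0%N = (words st3 16 0%N + size rest)%N.
    by rewrite e16 F3w // -addnA add1n; exact: p17'.
  have nb' i : (i < size rest)%N -> words st3 2 (words st3 16 0%N + i) = nth v0 rest i.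
    by move=> ir; rewrite F3w // e16 -addnA add1n; exact: nb i.+1 ir.
  have hq := inv_head _ _ _ _ _ _ _ _ _ _ _ _ _ I'.
  case: (boolP (w \in qs1)) q3' => wq q3'.
    by exists qs1, L1, P1, h, v, rest; split=> //; apply: search_skip I' wq.
  exists (rcons qs1 w), (set_at n _ L1 w (L1 v + 1)), (set_at n _ P1 w v), h, v, rest.
  split=> //; first exact: search_push I' wq.
  congr (12 * (_ + adjacency_weight _))%N; apply: funext => x /=.
  by rewrite -cats1 takel_cat.
- move=> k st1 s [qs1 [L1 [P1 [h [v [rest [[f q'] I' [hd' ru] [p17' nb] _]]]]]]] /=.
  have [q1 q2 q3 q4 q5] := q'; rewrite negbK hd' q1 p17' => /andP[r0 hq] sl.
  split=> //; exists qs1, L1, P1.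
  have re : rest = [::] by apply: size0nil; move: r0; case: (size rest) => // m; lia.
  have he : h = size qs1.
    by apply/eqP; rewrite eqn_leq hq (inv_head _ _ _ _ _ _ _ _ _ _ _ _ _ I').
  rewrite re he in I'.
  by have [all_q tree] := search_done _ _ _ conn _ _ _ _ cz norm_z _ _ _ _ I'.
- exists qs, L, P, 0%N, u, [::]; split=> //; first by rewrite p16 p17.
  by rewrite add0n; congr (12 * adjacency_weight _)%N; apply: funext => x /=; rewrite take0.
Qed.

Lemma push_source_spec (x y : nat) q st (v p : 'I_n) r qs L P :
  (x, y) \in [:: (7, 8); (8, 7)]%N ->
  words st x 0%N = v -> words st y 0%N = p ->
  (forall st', reals st' 2 0%N = reals st 2 0%N -> reval st' q = r) ->
  queue_in st qs L P ->
  wp (push_cmd (wvar x) (wvar y) q) st (fun st' t => [/\ (t <= 8)%N,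
    frame [:: 10; 11; 12; 14]%N [:: 3]%N st st' &
    if v \in qs then queue_in st' qs L P
    else queue_in st' (rcons qs v) (set_at n _ L v r) (set_at n _ P v p)]).
Proof.
move=> xy wx wy qr; apply: push_spec.
  by move=> st' [fW _]; move: xy wx wy; rewrite !inE => /orP[]/eqP[-> ->] /=; rewrite !fW.
by move=> st' [_ fV]; apply: qr; rewrite fV.
Qed.

(** A source at a vertex, with a = b and t = 0, takes the first branch, where the second push finds
    the vertex already stamped. In the other branch the ends are therefore distinct. *)
Lemma source_spec st z a b t : @describes R n e (a, b, t) z -> (a = b -> t = 0) ->
  words st 7 0%N = a -> words st 8 0%N = b -> reals st 2 0%N = t ->
  (forall L P, queue_in st [::] L P) ->
  wp (If (RLe (rvar 2) (RSub (RNat 1) (rvar 2)))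
        (Seq (push_cmd (wvar 7) (wvar 8) (rvar 2))
             (push_cmd (wvar 8) (wvar 7) (RSub (RNat 1) (rvar 2))))
        (Seq (push_cmd (wvar 8) (wvar 7) (RSub (RNat 1) (rvar 2)))
             (push_cmd (wvar 7) (wvar 8) (rvar 2)))) st
    (fun st' s => [/\ (s <= 17)%N, frame [:: 10; 11; 12; 14]%N [:: 3]%N st st' &
      exists qs L P, queue_in st' qs L P /\ search_inv R n e a b t z qs L P 0 v0 [::]]).
Proof.
move=> cz t0 wa wb rt q0.
have [L0 [P0 {}q0]] : exists L P, queue_in st [::] L P by exists (fun=> 0), id.
have setE T (f : 'I_n -> T) v x : set_at n _ f v x v = x by rewrite /set_at eqxx.
have setN T (f : 'I_n -> T) v w x : v != w -> set_at n _ f w x v = f v.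
  by rewrite /set_at => /negbTE->.
apply: wp_if => /=; rewrite rt; case: leP => tt; wp_step.
  apply: wp_mono (push_source_spec 7 8 (rvar 2) st a b t _ _ _ _ wa wb _ q0) _ => //.
    by move=> st' /= ->.
  move=> st1 s1 /= [s1l f1 q1]; have [F1w F1v] := f1.
  apply: wp_mono (push_source_spec 8 7 (RSub (RNat 1) (rvar 2)) st1 b a (1 - t) _ _ _ _ _ _ _ q1) _ => //.
  - by rewrite F1w.
  - by rewrite F1w.
  - by move=> st' /= ->; rewrite F1v // rt.
  move=> st2 s2 /= [s2l f2 q2]; split; [by lia | exact: frame_trans f1 f2 |].
  move: q2; rewrite inE; have [ba|ba] := eqVneq b a => q2.
    exists [:: a], (set_at n _ L0 a t), (set_at n _ P0 a b); split=> //.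
    by apply: search_start_vertex => //; rewrite setE.
  exists [:: a; b], (set_at n _ (set_at n _ L0 a t) b (1 - t)),
    (set_at n _ (set_at n _ P0 a b) b a); split=> //.
  have ab : a != b by rewrite eq_sym.
  by apply: search_start_edge => //; first [by rewrite setE | by rewrite setN // setE].
have ab : a != b by apply: contraTneq tt => /t0->; rewrite -leNgt; lra.
apply: wp_mono (push_source_spec 8 7 (RSub (RNat 1) (rvar 2)) st b a (1 - t) _ _ _ _ wb wa _ q0) _ => //.
  by move=> st' /= ->; rewrite rt.
move=> st1 s1 /= [s1l f1 q1]; have [F1w F1v] := f1.
apply: wp_mono (push_source_spec 7 8 (rvar 2) st1 a b t _ _ _ _ _ _ _ q1) _ => //.
- by rewrite F1w.
- by rewrite F1w.
- by move=> st' /= ->; rewrite F1v // rt.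
move=> st2 s2 /= [s2l f2 q2]; split; [by lia | exact: frame_trans f1 f2 |].
move: q2; rewrite inE (negbTE ab) => q2.
exists [:: b; a], (set_at n _ (set_at n _ L0 b (1 - t)) a t),
  (set_at n _ (set_at n _ P0 b a) a b); split=> //.
have ba : b != a by rewrite eq_sym.
apply: search_inv_swap; apply: search_start_edge => //; rewrite ?subKr;
  first [exact: describes_swap | exact: ltW | by rewrite setE | by rewrite setN // setE].
Qed.

(** Old stamps never exceed the counter, so incrementing it makes all of them stale and the queue
    empty. *)
Lemma search_spec st z : input_in st -> point_in R n e st 7 8 2 z ->
  (forall v : 'I_n, (words st 10 v <= words st 9 0)%N) ->
  wp search_cmd st (fun st' s => [/\ (s <= 12 * adjacency_weight predT + 30)%N,
    frame (iota 9 10) [:: 3]%N st st', tree_in R n e st' z &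
    forall v : 'I_n, (words st' 10 v <= words st' 9 0)%N]).
Proof.
have time_le s1 s2 w : (s1 <= 17 -> s2 <= w + 1 ->
    1 + (1 + (1 + (1 + 1))) + (s1 + s2) <= w + 30)%N by lia.
move=> inp [a [b [wa wb cz t0]]] old; rewrite /search_cmd; do 2!wp_step.
do 4!(wp_step; wp_step); rewrite /= /update /=; set t := reals st 2 0%N in cz t0.
set st1 := word_set R _ _ _ _.
have f1 : frame (iota 9 10) [:: 3]%N st st1 by frame_tac.
have q0 L P : queue_in st1 [::] L P.
  split=> //= v; rewrite /update /= in_nil; apply/negbTE.
  by rewrite neq_ltn (leq_ltn_trans (old v)) // addn1.
wp_step; apply: wp_mono (source_spec st1 z a b t cz t0 _ _ _ q0) _ => //.
move=> st2 s2 [s2l f2 [qs [L [P [q I]]]]].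
have inp1 : input_in st1 by apply: frame_input inp f1 _ _.
have inp2 : input_in st2 by apply: frame_input inp1 f2 _ _.
have [F2w F2v] := f2.
apply: wp_mono (search_loop_spec a b t z qs L P v0 st2 inp2 cz t0 q I _ _ _) _.
- by rewrite F2w.
- by rewrite F2w.
- by rewrite F2w.
move=> st3 s3 [s3l f3 [qs' [L' [P' [[q1 q2 q3 q4 q5] all_q tree]]]]].
have [F3w F3v] := f3.
have f13 : frame (iota 9 10) [:: 3]%N st st3.
  apply: frame_trans f1 (frame_trans _ _ _ _ st2 _ _ _).
    by apply: frame_sub f2 _ _.
  by apply: frame_sub f3 _ _.
have [F13w F13v] := f13.
split=> //; first exact: time_le.
- exists a, b, L', P'; split=> //; rewrite ?F13w // ?F13v //.
  + by move=> v; apply: q4.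
  + by move=> v; apply: q5.
- by move=> v; have /eqP-> : words st3 10 v == words st3 9 0%N by rewrite q3.
Qed.

End SearchProgram.

(** * Scanning S *)

Section ScanProgram.
Variables (R : realType) (n : nat) (e : rel 'I_n).
Hypothesis simple : simple_graph e.
Hypothesis conn : connected_graph e.
Local Notation X := (graph_point R e).
Variable d : X -> X -> R.
Hypothesis dE : d = @graph_dist R n e.
Local Notation st_t := (state R unit).
Local Notation wp := (@wp R).
Local Notation frame := (@frame R).
Implicit Types st : st_t.
Variables (adj : 'I_n -> seq 'I_n) (S : seq X) (descr : X -> 'I_n * 'I_n * R).
Hypothesis adjP : adjacency_lists e adj.
Hypothesis descrP : forall x, x \in S -> describes (descr x) x.
Variables (v0 : 'I_n).
Hypothesis v00 : v0 = 0%N :> nat.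
Local Notation input_in := (input_in R n e adj S descr).
Local Notation pnt := (pnt R n e S v0).
Local Notation tree_in := (tree_in R n e).

Definition scan_value acc st z i : R :=
  if acc then Num.min (reals st 4 i) (d z (pnt i)) else d z (pnt i).

Definition scan_done acc st z st' N : Prop :=
  [/\ forall i, (i < N)%N -> reals st' 4 i = scan_value acc st z i,
      forall i, (i < N)%N -> scan_value acc st z i <= reals st' 7 0%N,
      (0 < N)%N -> (words st' 23 0 < N)%N /\
        reals st' 7 0%N = scan_value acc st z (words st' 23 0%N) &
      N = 0%N -> words st' 23 0%N = 0%N /\ reals st' 7 0%N = 0].

(** The last clause preserves the earlier values of the points still to be scanned, with which [acc]
    takes minima. *)
Definition scan_inv acc st z (k : nat) st' : Prop := exists j,
  [/\ frame [:: 20; 21; 22; 23; 26]%N [:: 4; 5; 6; 7; 9; 10]%N st st',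
      words st' 22 0%N = j /\ (j <= size S)%N, k = (70 * (size S - j))%N,
      scan_done acc st z st' j & forall i, (j <= i)%N -> reals st' 4 i = reals st 4 i].

Lemma acc_spec acc st z j : words st 22 0%N = j -> reals st 6 0%N = d z (pnt j) ->
  wp (if acc then If (rlt (RGet 4 (wvar 22)) (rvar 6)) (rset 6 (RGet 4 (wvar 22))) Skip
      else Skip) st (fun st' t => [/\ (t <= 2)%N, frame [::] [:: 6]%N st st' &
    reals st' 6 0%N = scan_value acc st z j]).
Proof.
rewrite /scan_value; case: acc => w22 r6; last by wp_step.
apply: wp_if; rewrite beval_rlt /= w22 r6; case: ltP => le; wp_step; split=> //.
- by frame_tac.
- by rewrite /= /update /= w22.
Qed.

Lemma best_spec acc st1 z (st : st_t) j N :
  words st 22 0%N = j -> (j < N)%N -> N = size S ->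
  scan_done acc st1 z st j -> (forall i, (j < i)%N -> reals st 4 i = reals st1 4 i) ->
  0 <= scan_value acc st1 z j -> reals st 6 0%N = scan_value acc st1 z j ->
  wp (Seq (RSet 4 (wvar 22) (rvar 6))
       (Seq (If (RLe (rvar 7) (rvar 6)) (Seq (rset 7 (rvar 6)) (wset 23 (wvar 22))) Skip)
         (wset 22 (WAdd (wvar 22) (WNat 1))))) st
    (fun st' t => [/\ (t <= 6)%N, frame [:: 22; 23]%N [:: 4; 7]%N st st',
      words st' 22 0%N = j.+1, scan_done acc st1 z st' j.+1 &
      forall i, (j < i)%N -> reals st' 4 i = reals st1 4 i]).
Proof.
move=> w22 jN NS [D1 D2 D3 D4] D5 val0 r6.
have upd (f : nat -> R) i : (i < j.+1)%N -> (forall i, (i < j)%N -> f i = scan_value acc st1 z i) ->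
    (if i == j then scan_value acc st1 z j else f i) = scan_value acc st1 z i.
  move=> ij fE; case: eqP => [->//|/eqP ne]; apply: fE.
  by rewrite ltn_neqAle ne -ltnS.
do 2!wp_step; rewrite /= w22 r6; set st2 := real_set _ _ _ _ _; wp_step.
apply: wp_if; rewrite /= /update /= r6; case: leP => le.
  do 2!(wp_step; wp_step); rewrite /= /update /= w22 !addn1.
  split=> //; first by frame_tac.
    split=> //=.
    - by move=> i ij; rewrite /update /= upd.
    - move=> i; rewrite ltnS leq_eqVlt /update /= r6 => /orP[/eqP->//|ij].
      exact: le_trans (D2 _ ij) le.
  by move=> i ij; rewrite /= /update /= gtn_eqF // D5.
wp_step; wp_step; rewrite /= w22 !addn1.
(* The best value starts at 0 and all values are nonnegative, so the first point always passes the
   test and cannot lead here. *)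
have j0 : (0 < j)%N.
  by rewrite lt0n; apply: contraTneq le => /D4[_ ->]; rewrite -leNgt.
have [D3a D3b] := D3 j0.
split=> //; first by frame_tac.
  split=> //=.
  - by move=> i ij; rewrite /update /= upd.
  - move=> i; rewrite ltnS leq_eqVlt /update /= => /orP[/eqP->|ij]; first exact: ltW.
    exact: D2.
  - by move=> _; rewrite /update /= ltnS ltnW.
by move=> i ij; rewrite /= /update /= gtn_eqF // D5.
Qed.

Lemma scan_spec acc st z : input_in st -> tree_in st z ->
  (forall i, (i < size S)%N -> 0 <= scan_value acc st z i) ->
  wp (scan_cmd acc) st (fun st' t => [/\ (t <= 70 * size S + 10)%N,
    frame [:: 20; 21; 22; 23; 26]%N [:: 4; 5; 6; 7; 9; 10]%N st st' &
    scan_done acc st z st' (size S)]).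
Proof.
have time_le t1 t2 t3 t4 j : (j < size S -> t1 <= 10 -> t2 <= 40 -> t3 <= 2 -> t4 <= 6 ->
    t1 + (t2 + (t3 + t4)) + 1 + 70 * (size S - j.+1) <= 70 * (size S - j))%N by lia.
have time_le' t : (t <= 70 * size S + 1 -> 1 + (1 + 1) + t <= 70 * size S + 10)%N by lia.
move=> inp tz val0; rewrite /scan_cmd; do 2!wp_step; wp_step; do 2!wp_step; wp_step.
apply: (wp_while R _ _ (scan_inv acc st z) (70 * size S)%N).
- move=> k st1 [j [f1 [w22 jS] -> D D5]].
  have inp1 : input_in st1 by apply: frame_input inp f1 _ _.
  have tz1 : tree_in st1 z by apply: frame_tree tz f1 isT.
  have w01 : words st1 0 1 = size S.
    by have [iW _] := inp1; rewrite iW //= size_map.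
  rewrite /= w22 w01 -ltnNge => jN.
  wp_step; apply: wp_mono (load_spec _ _ _ _ _ _ descrP _ v00 st1 22 20 21 5 _ _ inp1) _ => //.
  move=> st2 t2 [t2l f2 p2]; have tz2 : tree_in st2 z by apply: frame_tree tz1 f2 isT.
  rewrite w22 in p2.
  wp_step; apply: wp_mono (dist_spec _ _ _ simple conn d dE v0 v00 st2 z (pnt j) tz2 p2) _.
  move=> st3 t3 [t3l f3 [_ r6 _]].
  have f13 : frame [:: 20; 21; 26]%N [:: 5; 6; 9; 10]%N st1 st3.
    by apply: frame_trans (frame_sub _ _ _ _ _ _ _ f2 _ _) f3.
  have [F13w F13v] := f13.
  have w22' : words st3 22 0%N = j by rewrite F13w.
  have v3 : scan_value acc st3 z j = scan_value acc st z j.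
    by rewrite /scan_value F13v // D5.
  wp_step; apply: wp_mono (acc_spec acc st3 z j w22' r6) _ => st4 t4 [t4l f4 r6'].
  rewrite v3 in r6'; have [F4w F4v] := f4.
  have D' : scan_done acc st z st4 j.
    case: D => D1 D2 D3 D4; split.
    - by move=> i ij; rewrite F4v // F13v // D1.
    - by move=> i ij; rewrite F4v // F13v // D2.
    - by move=> j0; rewrite F4w // F13w // F4v // F13v //; apply: D3.
    - by move=> j0; rewrite F4w // F13w // F4v // F13v //; apply: D4.
  have D5' i : (j < i)%N -> reals st4 4 i = reals st 4 i.
    by move=> ji; rewrite F4v // F13v // D5 // ltnW.
  have w22'' : words st4 22 0%N = j by rewrite F4w.
  apply: wp_mono (best_spec acc st z st4 j (size S) w22'' jN erefl D' D5' (val0 j jN) r6') _.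
  move=> st5 t5 [t5l f5 w5 D'' D5''].
  exists (70 * (size S - j.+1))%N; last exact: time_le.
  exists j.+1; split=> //.
  apply: frame_trans f1 _; apply: (frame_trans _ _ _ _ st3).
    by apply: frame_sub f13 _ _.
  by apply: (frame_trans _ _ _ _ st4); [apply: frame_sub f4 _ _ | apply: frame_sub f5 _ _].
- move=> k st1 t [j [f1 [w22 jS] _ D _]].
  have inp1 : input_in st1 by apply: frame_input inp f1 _ _.
  have w01 : words st1 0 1 = size S.
    by have [iW _] := inp1; rewrite iW //= size_map.
  rewrite /= negbK w01 w22 => Sj tl; split=> //; first exact: time_le'.
  by have -> : size S = j by apply/eqP; rewrite eqn_leq Sj.
- exists 0%N; split=> //; first by frame_tac.
  by rewrite subn0.
Qed.

Lemma sweep_spec acc st z : input_in st -> point_in R n e st 7 8 2 z ->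
  (forall v : 'I_n, (words st 10 v <= words st 9 0)%N) ->
  (forall i, (i < size S)%N -> 0 <= scan_value acc st z i) ->
  wp (sweep_cmd acc) st (fun st' t => [/\
    (t <= 12 * adjacency_weight n adj predT + 70 * size S + 40)%N /\
    frame (iota 9 10 ++ [:: 20; 21; 22; 23; 26])%N [:: 3; 4; 5; 6; 7; 9; 10]%N st st',
    tree_in st' z, forall v : 'I_n, (words st' 10 v <= words st' 9 0)%N &
    scan_done acc st z st' (size S)]).
Proof.
have time_le t1 t2 w : (t1 <= w + 30 -> t2 <= 70 * size S + 10 ->
  t1 + t2 <= w + 70 * size S + 40)%N by lia.
move=> inp pz old val0; wp_step.
apply: wp_mono (search_spec _ _ _ simple conn _ _ _ adjP v0 st z inp pz old) _.
move=> st1 t1 [t1l f1 tz1 old1]; have [F1w F1v] := f1.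
have inp1 : input_in st1 by apply: frame_input inp f1 _ _.
have vE i : scan_value acc st1 z i = scan_value acc st z i by rewrite /scan_value F1v.
apply: wp_mono (scan_spec acc st1 z inp1 tz1 _) _; first by move=> i iN; rewrite vE val0.
move=> st2 t2 [t2l f2 D]; have [F2w F2v] := f2; split.
- split; first exact: time_le.
  by apply: (frame_trans _ _ _ _ st1); [apply: frame_sub f1 _ _ | apply: frame_sub f2 _ _].
- by apply: frame_tree tz1 f2 isT.
- by move=> v; rewrite !F2w.
- case: D => D1 D2 D3 D4; split=> //.
  + by move=> i iN; rewrite -vE D1.
  + by move=> i iN; rewrite -vE D2.
  + by move=> N0; rewrite -vE; apply: D3.
Qed.

Lemma place_spec k st z y : tree_in st z -> point_in R n e st 20 21 5 y ->
  0 <= reals st 8 0%N <= d z y ->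
  wp (place_cmd k) st (fun st' t => [/\ (t <= 2 * n + 60)%N,
    frame [:: 5; 6; 20; 21; 25; 26]%N [:: 1; 5; 6; 9; 10]%N st st',
    same_outputs R st st' k & exists c, [/\ output_in R n e st' k c,
      d z c = reals st 8 0%N & d z c + d c y = d z y]]).
Proof.
have time_le t1 t2 : (t1 <= 40 -> t2 <= 2 * n + 20 -> t1 + t2 <= 2 * n + 60)%N by lia.
move=> tz py rl; wp_step.
apply: wp_mono (dist_spec _ _ _ simple conn d dE v0 v00 st z y tz py) _ => st1 t1 [t1l f1 D1].
have [F1w F1v] := f1; have tz1 : tree_in st1 z by apply: frame_tree tz f1 isT.
have r8 : reals st1 8 0%N = reals st 8 0%N by rewrite F1v.
have rl1 : 0 <= reals st1 8 0%N <= reals st1 6 0%N by rewrite r8; case: D1 => _ ->.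
apply: wp_mono (center_spec _ _ _ simple conn d dE v0 v00 st1 z y k tz1 D1 rl1) _.
move=> st2 t2 [t2l f2 so oc]; split; first exact: time_le.
- by apply: (frame_trans _ _ _ _ st1); [apply: frame_sub f1 _ _ | apply: frame_sub f2 _ _].
- by move=> j jk; have [-> -> ->] := so _ jk; rewrite !F1w // F1v.
- by rewrite -r8.
Qed.

End ScanProgram.

(** * Correctness on graphs *)

Section GraphProgram.
Variables (R : realType) (n : nat) (e : rel 'I_n).
Hypothesis simple : simple_graph e.
Hypothesis conn : connected_graph e.
Local Notation X := (graph_point R e).
Variable d : X -> X -> R.
Hypothesis dE : d = @graph_dist R n e.
Local Notation st_t := (state R unit).
Local Notation wp := (@wp R).
Local Notation frame := (@frame R).
Implicit Types st : st_t.
Variables (adj : 'I_n -> seq 'I_n) (S : seq X) (descr : X -> 'I_n * 'I_n * R).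
Hypothesis adjP : adjacency_lists e adj.
Hypothesis descrP : forall x, x \in S -> describes (descr x) x.
Variables (v0 : 'I_n).
Hypothesis v00 : v0 = 0%N :> nat.
Local Notation input_in := (input_in R n e adj S descr).
Local Notation pnt := (pnt R n e S v0).
Local Notation tree_in := (tree_in R n e).
Local Notation point_in := (point_in R n e).
Local Notation x0 := (vertex v0 : X).
Local Notation stamped st := (forall v : 'I_n, (words st 10 v <= words st 9 0)%N).

Let dP : pseudometric R X d.
Proof. by rewrite dE; apply: graph_pseudometric. Qed.

Let d0 x y : 0 <= d x y. Proof. exact: pseudometric_ge0 dP x y. Qed.

Let work := (12 * adjacency_weight n adj predT + 70 * size S)%N.

Definition two_sweeps_done st (i1 i2 : nat) : Prop :=
  [/\ [/\ input_in st, tree_in st (pnt i1), stamped st,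
        words st 24 0%N = i1 & words st 23 0%N = i2],
    forall i, (i < size S)%N -> d x0 (pnt i) <= d x0 (pnt i1),
    forall i, (i < size S)%N -> d (pnt i1) (pnt i) <= d (pnt i1) (pnt i2) /\
      reals st 4 i = d (pnt i1) (pnt i),
    reals st 7 0%N = d (pnt i1) (pnt i2) &
    (0 < size S)%N -> (i1 < size S)%N /\ (i2 < size S)%N].

Lemma pnt_empty i : size S = 0%N -> pnt i = x0.
Proof. by move=> S0; rewrite /pnt nth_default // S0. Qed.

Lemma two_sweeps_spec :
  wp (Seq (Seq (load0_cmd 7 8 2) (sweep_cmd false))
       (Seq (wset 24 (wvar 23)) (Seq (load_cmd 24 7 8 2) (sweep_cmd false))))
    (graph_input adj (map descr S))
    (fun st t => (t <= 2 * work + 101)%N /\ exists i1 i2, two_sweeps_done st i1 i2).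
Proof.
have time_le t1 t2 t3 t4 : (t1 <= 10 -> t2 <= work + 40 -> t3 <= 10 -> t4 <= work + 40 ->
  (t1 + t2) + (1 + (t3 + t4)) <= 2 * work + 101)%N by lia.
set st0 := graph_input _ _; have inp0 : input_in st0 by [].
do 2!wp_step; apply: wp_mono (load0_spec R n e v0 v00 st0 7 8 2 _) _ => //.
move=> st1 t1 [t1l f1 p1]; have [F1w F1v] := f1.
have inp1 : input_in st1 by apply: frame_input inp0 f1 _ _.
apply: wp_mono (sweep_spec _ _ _ simple conn d dE adj S descr adjP descrP v0 v00 false st1 x0 inp1 p1 _ _) _.
- by move=> v; rewrite !F1w.
- by move=> i _; apply: d0.
move=> st2 t2 [[t2l f2] tz2 old2 D2]; have [F2w F2v] := f2.
have inp2 : input_in st2 by apply: frame_input inp1 f2 _ _.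
do 2!wp_step; rewrite /=; set i1 := words st2 23 0%N.
set st3 := word_set R st2 _ _ _.
have w24 : words st3 24 0%N = i1 by [].
have inp3 : input_in st3.
  by apply: (frame_input _ _ _ _ _ _ [:: 24%N] [::] _ _ inp2) => //; frame_tac.
wp_step; apply: wp_mono (load_spec _ _ _ _ _ _ descrP _ v00 st3 24 7 8 2 _ _ inp3) _ => //.
move=> st4 t4 [t4l f4 p4]; have [F4w F4v] := f4; rewrite w24 in p4.
have inp4 : input_in st4 by apply: frame_input inp3 f4 _ _.
apply: wp_mono (sweep_spec _ _ _ simple conn d dE adj S descr adjP descrP v0 v00 false st4 _ inp4 p4 _ _) _.
- by move=> v; rewrite !F4w // /st3 /= /update /= old2.
- by move=> i _; apply: d0.
move=> st5 t5 [[t5l f5] tz5 old5 D5]; have [F5w F5v] := f5.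
split; first exact: time_le.
have [E1 E2 E3 E4] := D2; have [G1 G2 G3 G4] := D5.
have inp5 : input_in st5 by apply: frame_input inp4 f5 _ _.
exists i1, (words st5 23 0%N); split.
- by split=> //; rewrite F5w // F4w.
- move=> i iN; have N0 : (0 < size S)%N by apply: leq_ltn_trans iN.
  by have := E2 i iN; have [_ ->] := E3 N0.
- move=> i iN; have N0 : (0 < size S)%N by apply: leq_ltn_trans iN.
  by have := G2 i iN; have [_ ->] := G3 N0; rewrite G1.
- have [N0|N0] := posnP (size S); last by have [_ ->] := G3 N0.
  have [_ ->] := G4 N0; rewrite !pnt_empty //.
  by have [dxx _ _] := dP; rewrite dxx.
- by move=> N0; have [lt1 _] := E3 N0; have [lt2 _] := G3 N0.
Qed.

Lemma place0_spec st z : tree_in st z -> 0 <= reals st 8 0%N <= d z x0 ->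
  wp (Seq (load0_cmd 20 21 5) (place_cmd 0)) st (fun st' t => [/\ (t <= 2 * n + 70)%N,
    same_outputs R st st' 0 & exists c, [/\ output_in R n e st' 0 c,
      d z c = reals st 8 0%N & d z c + d c x0 = d z x0]]).
Proof.
have time_le t1 t2 : (t1 <= 10 -> t2 <= 2 * n + 60 -> t1 + t2 <= 2 * n + 70)%N by lia.
move=> tz rl; wp_step; apply: wp_mono (load0_spec R n e v0 v00 st 20 21 5 _) _ => //.
move=> st1 t1 [t1l f1 p1]; have [F1w F1v] := f1.
have tz1 : tree_in st1 z by apply: frame_tree tz f1 isT.
have r8 : reals st1 8 0%N = reals st 8 0%N by rewrite F1v.
apply: wp_mono (place_spec _ _ _ simple conn d dE v0 v00 0 st1 z x0 tz1 p1 _) _; rewrite r8 //.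
move=> st2 t2 [t2l f2 so oc]; split=> //; first exact: time_le.
by move=> j jk; have [-> -> ->] := so _ jk; rewrite !F1w // F1v.
Qed.

Variable delta : R.
Hypothesis hyp : delta_hyperbolic d delta.

Let geo : geodesic_space d.
Proof. by rewrite dE; apply: graph_geodesic_space. Qed.

Lemma card_range_ord p (c : 'I_p -> X) : (range c #<= `I_p)%card.
Proof.
apply: card_le_trans (card_image_le (fun i => if insub i is Some k then c k else x0) `I_p).
apply: subset_card_le => _ [k _ <-]; exists (k : nat); first exact: ltn_ord.
by rewrite valK.
Qed.

Lemma memS_pnt s : [set` S] s -> exists2 i, (i < size S)%N & s = pnt i.
Proof. by move=> /= sS; exists (index s S); rewrite ?index_mem // /pnt nth_index. Qed.

Lemma graph_prog1_spec : exists st time (c : 'I_1 -> X),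
  [/\ exec (@no_step R) (graph_prog 1) (graph_input adj (map descr S)) st time,
      (time <= 5 * (work + 2 * n + 200))%N, graph_output st c &
      dominates d (range c) (p_radius d 1 [set` S] + delta) [set` S]].
Proof.
have time_le t1 t2 : (t1 <= 2 * work + 101 -> t2 <= 2 * n + 70 ->
  t1 + (1 + t2) <= 5 * (work + 2 * n + 200))%N by lia.
suff : wp (graph_prog 1) (graph_input adj (map descr S)) (fun st t =>
    (t <= 5 * (work + 2 * n + 200))%N /\ exists c : 'I_1 -> X, graph_output st c /\
    dominates d (range c) (p_radius d 1 [set` S] + delta) [set` S]).
  by move=> [st [t [ex [tl [c [oc dom]]]]]]; exists st, t, c.
wp_step; apply: wp_mono two_sweeps_spec _.
move=> st1 t1 [t1l [i1 [i2 [[inp1 tz1 old1 w24 w23] far1 far2 r7 lt12]]]].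
have [_ dC dT] := dP.
do 2!wp_step; rewrite /= r7; set st2 := real_set R st1 _ _ _.
have tz2 : tree_in st2 (pnt i1).
  by apply: (frame_tree _ _ _ [::] [:: 8%N] _ _ _ tz1) => //; frame_tac.
have r8 : reals st2 8 0%N = d (pnt i1) (pnt i2) / 2 by [].
have rl : 0 <= d (pnt i1) (pnt i2) / 2 <= d (pnt i1) x0.
  (* For empty S a center is still placed, with vertex 0 as z1 and z2 and radius 0, and the run must
     be shown to succeed. *)
  have [N0|N0] := posnP (size S).
    have [dxx _ _] := dP.
    by rewrite !pnt_empty // dxx mul0r lexx.
  have [_ lt2] := lt12 N0; have := far1 _ lt2; have := dT (pnt i1) x0 (pnt i2).
  have := d0 (pnt i1) (pnt i2); rewrite (dC x0 (pnt i1)); lra.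
apply: wp_mono (place0_spec st2 (pnt i1) tz2 _) _; first by rewrite r8.
move=> st3 t3 [t3l _ [c [oc zc zcx]]]; split; first exact: time_le.
exists (fun=> c); split.
  by move=> i; rewrite ord1; have [u [v H]] := oc; exists u, v.
move=> s Ss; have [i iN _] := memS_pnt s Ss.
have N0 : (0 < size S)%N by apply: leq_ltn_trans iN.
have [lt1 lt2] := lt12 N0.
apply: (one_center_dominates _ _ d delta [set` S] dP hyp geo x0 (pnt i1) (pnt i2) _ _ _ _ c) => //.
- exact: mem_nth.
- exact: mem_nth.
- by move=> s' /memS_pnt[k kN ->]; apply: far1.
- by move=> s' /memS_pnt[k kN ->]; case: (far2 k kN).
- by exists ord0.
- exact: card_range_ord.
Qed.

Lemma graph_prog2_spec : exists st time (c : 'I_2 -> X),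
  [/\ exec (@no_step R) (graph_prog 2) (graph_input adj (map descr S)) st time,
      (time <= 5 * (work + 2 * n + 200))%N, graph_output st c &
      dominates d (range c) (p_radius d 2 [set` S] + delta) [set` S]].
Proof.
have time_le t1 t2 t3 t4 t5 t6 t7 t8 :
  (t1 <= 2 * work + 101 -> t2 <= 10 -> t3 <= work + 40 -> t4 <= 10 -> t5 <= 2 * n + 60 ->
   t6 <= 10 -> t7 <= work + 40 -> t8 <= 2 * n + 70 ->
   t1 + ((t2 + (t3 + 1)) + ((t4 + t5) + ((t6 + t7) + t8))) <= 5 * (work + 2 * n + 200))%N by lia.
suff : wp (graph_prog 2) (graph_input adj (map descr S)) (fun st t =>
    (t <= 5 * (work + 2 * n + 200))%N /\ exists c : 'I_2 -> X, graph_output st c /\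
    dominates d (range c) (p_radius d 2 [set` S] + delta) [set` S]).
  by move=> [st [t [ex [tl [c [oc dom]]]]]]; exists st, t, c.
wp_step; apply: wp_mono two_sweeps_spec _.
move=> st1 t1 [t1l [i1 [i2 [[inp1 tz1 old1 w24 w23] far1 far2 r7 lt12]]]].
have [dxx dC dT] := dP.
set z1 := pnt i1 in tz1 far1 far2 r7 *; set z2 := pnt i2 in far2 r7 *.
do 2!wp_step; apply: wp_mono (load_spec _ _ _ _ _ _ descrP _ v00 st1 23 7 8 2 _ _ inp1) _ => //.
move=> st2 t2 [t2l f2 p2]; have [F2w F2v] := f2; rewrite w23 -/z2 in p2.
have inp2 : input_in st2 by apply: frame_input inp1 f2 _ _.
have old2 : stamped st2 by move=> v; rewrite !F2w.
have valE i : (i < size S)%N ->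
    scan_value R n e d S v0 true st2 z2 i = Num.min (d z1 (pnt i)) (d z2 (pnt i)).
  by move=> iN; rewrite /scan_value F2v //; have [_ ->] := far2 i iN.
wp_step; apply: wp_mono (sweep_spec _ _ _ simple conn d dE adj S descr adjP descrP v0 v00 true st2 z2 inp2 p2 old2 _) _.
  by move=> i iN; rewrite valE // le_min !d0.
move=> st3 t3 [[t3l f3] tz3 old3 D3]; have [F3w F3v] := f3.
have inp3 : input_in st3 by apply: frame_input inp2 f3 _ _.
have [E1 E2 E3 E4] := D3.
wp_step; rewrite /=; set r := reals st3 7 0%N / 2; set st4 := real_set R st3 _ _ _.
have f34 : frame [::] [:: 8%N] st3 st4 by frame_tac.
have tz4 : tree_in st4 z2 by apply: frame_tree tz3 f34 isT.
have inp4 : input_in st4 by apply: frame_input inp3 f34 _ _.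
have r8 : reals st4 8 0%N = r by [].
have w24' : words st4 24 0%N = i1 by rewrite /= F3w // F2w.
have rl : [/\ 0 <= r, r <= d z2 z1 & r <= d z1 x0].
  have [N0|N0] := posnP (size S).
    by rewrite /r /z1 /z2 !pnt_empty // dxx; have [_ ->] := E4 N0; rewrite mul0r.
  have [lt1 lt2] := lt12 N0; have [lt3 r73] := E3 N0.
  rewrite valE // in r73; have [le12 _] := far2 _ lt3.
  have m1 : 2 * r <= d z1 (pnt (words st3 23 0%N)).
    by rewrite /r r73 mulrC divfK ?pnatr_eq0 // ge_min lexx.
  have r0 : 0 <= r by rewrite /r r73 divr_ge0 ?ler0n // le_min !d0.
  have := far1 _ lt2; have := dT z1 x0 z2; rewrite (dC x0 z1) (dC z2 z1) -/z2.
  by split; lra.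
have [r0 r21 r10] := rl.
do 2!wp_step; apply: wp_mono (load_spec _ _ _ _ _ _ descrP _ v00 st4 24 20 21 5 _ _ inp4) _ => //.
move=> st5 t5 [t5l f5 p5]; have [F5w F5v] := f5; rewrite w24' -/z1 in p5.
have tz5 : tree_in st5 z2 by apply: frame_tree tz4 f5 isT.
have inp5 : input_in st5 by apply: frame_input inp4 f5 _ _.
have r85 : reals st5 8 0%N = r by rewrite F5v.
apply: wp_mono (place_spec _ _ _ simple conn d dE v0 v00 1 st5 z2 z1 tz5 p5 _) _.
  by rewrite r85 r0 r21.
move=> st6 t6 [t6l f6 _ [c2 [oc2 zc2 zcz2]]]; have [F6w F6v] := f6; rewrite r85 in zc2.
have inp6 : input_in st6 by apply: frame_input inp5 f6 _ _.
have w246 : words st6 24 0%N = i1 by rewrite F6w // F5w.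
(* Only one tree is stored, and the third sweep replaced that of z1 by that of z2. It is rebuilt
   here to place the center on [z1, x0]. *)
do 2!wp_step; apply: wp_mono (load_spec _ _ _ _ _ _ descrP _ v00 st6 24 7 8 2 _ _ inp6) _ => //.
move=> st7 t7 [t7l f7 p7]; have [F7w F7v] := f7; rewrite w246 -/z1 in p7.
have inp7 : input_in st7 by apply: frame_input inp6 f7 _ _.
have old7 : stamped st7.
  by move=> v; rewrite !F7w // !F6w // !F5w //; apply: old3.
apply: wp_mono (search_spec _ _ _ simple conn _ _ _ adjP v0 st7 z1 inp7 p7 old7) _.
move=> st8 t8 [t8l f8 tz8 _]; have [F8w F8v] := f8.
have r88 : reals st8 8 0%N = r by rewrite F8v // F7v // F6v.
apply: wp_mono (place0_spec st8 z1 tz8 _) _; first by rewrite r88 r0 r10.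
move=> st9 t9 [t9l so [c1 [oc1 zc1 zcx]]]; rewrite r88 in zc1.
split.
  by apply: time_le => //; apply: leq_trans t8l _; rewrite /work; lia.
exists (fun k : 'I_2 => if k == ord0 then c1 else c2); split.
  move=> k; have [->|k0] := eqVneq k ord0; first by have [u [v H]] := oc1; exists u, v.
  have k1 : k = 1%N :> nat by case: k k0 => [[|[|k]] kl].
  have [u [v [wu wv cc]]] := oc2; exists u, v; rewrite k1.
  have [-> -> ->] := so 1%N isT.
  by rewrite !F8w // !F7w // F8v // F7v.
move=> s Ss; have [i iN _] := memS_pnt s Ss.
have N0 : (0 < size S)%N by apply: leq_ltn_trans iN.
have [lt1 lt2] := lt12 N0; have [lt3 r73] := E3 N0.
rewrite valE // in r73.
apply: (two_centers_dominate _ _ d delta [set` S] dP hyp geo x0 z1 z2 _ _ _ _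
  (pnt (words st3 23 0%N)) c1 c2 r) => //.
- exact: mem_nth.
- exact: mem_nth.
- by move=> s' /memS_pnt[k kN ->]; apply: far1.
- by move=> s' /memS_pnt[k kN ->]; case: (far2 k kN).
- exact: mem_nth.
- by rewrite -r73 /r mulrC divfK ?pnatr_eq0.
- by move=> s' /memS_pnt[k kN ->]; rewrite -r73 -valE //; apply: E2.
- by exists ord0.
- by exists (lift ord0 ord0).
- exact: card_range_ord.
Qed.

End GraphProgram.

(** * Size of the input and the final time bound *)

Lemma sum_degree_le n (e : rel 'I_n) : simple_graph e ->
  (\sum_v #|e v| <= 2 * num_edges e)%N.
Proof.
move=> [eC eI]; set E := [set uv : 'I_n * 'I_n | (uv.1 < uv.2)%N && e uv.1 uv.2]%SET.
have -> : num_edges e = #|E|.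
  apply: eq_card => uv; rewrite [RHS]inE.
  by apply/idP/idP => [/set_mem|uvE]; [| exact: mem_set].
pose swap (uv : 'I_n * 'I_n) := (uv.2, uv.1).
have -> : (\sum_v #|e v| = #|[set uv : 'I_n * 'I_n | e uv.1 uv.2]%SET|)%N.
  rewrite -sum1_card (eq_bigl (fun uv : 'I_n * 'I_n => true && e uv.1 uv.2)) => [|uv]; last by rewrite inE.
  rewrite -(pair_big_dep xpredT (fun u v => e u v) (fun _ _ => 1%N)) /=.
  by apply: eq_bigr => u _; rewrite sum1_card.
(* Handshake: without loops, every arc or its reversal is increasing. *)
have sub : [set uv : 'I_n * 'I_n | e uv.1 uv.2]%SET \subset (E :|: [set swap uv | uv in E])%SET.
  apply/fintype.subsetP => -[u v]; rewrite !inE /= => uv.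
  have [lt|gt|eq] := ltngtP u v; first by rewrite uv.
    by apply/orP; right; apply/imsetP; exists (v, u) => //; rewrite inE /= gt eC.
  by move: uv; rewrite (val_inj eq) eI.
apply: leq_trans (subset_leq_card sub) _; apply: leq_trans (leq_card_setU _ _) _.
by rewrite mul2n -addnn; rewrite leq_add2l leq_imset_card.
Qed.

(** Scanning S costs time proportional to its size. Distinct points at vertices number at most n;
    interior points are part of the input and appear as a separate term of the bound. *)
Lemma size_points_le (R : realType) n (e : rel 'I_n) (S : seq (graph_point R e)) :
  uniq S -> (size S <= n + count (fun x => ~~ is_vertex x) S)%N.
Proof.
move=> uS; rewrite -(count_predC (@is_vertex R n e)) leq_add2r -size_filter.
pose f (x : graph_point R e) := [pick u | val x 0 u == 1].
have f_inj : {in [seq x <- S | is_vertex x] &, injective f}.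
  have fE x : x \in [seq x <- S | is_vertex x] -> exists2 u, f x = Some u & val x = delta_mx 0 u.
    rewrite mem_filter /f => /andP[/existsP[u0 xu0] _]; case: pickP => [u /eqP xu|/(_ u0)]; last by rewrite xu0.
    exists u => //; have /and3P[/forallP x0 /eqP x1 _] := valP x.
    have rest0 : \sum_(i < n | i != u) val x 0 i = 0.
      by move: x1; rewrite (bigD1 u) //= xu => /(canRL (addKr _)) ->; rewrite addNr.
    apply/rowP => i; rewrite !mxE /=; have [->|iu] := eqVneq i u; first by [].
    by have := psumr_eq0P (fun i _ => x0 i) rest0 iu.
  move=> x y /fE[u fx vx] /fE[v fy vy]; rewrite fx fy => -[uv].
  by apply: val_inj; rewrite vx vy uv.
rewrite -(size_map f); apply: leq_trans (uniq_leq_size (s2 := map some (enum 'I_n)) _ _) _.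
- by rewrite map_inj_in_uniq // filter_uniq.
- move=> _ /mapP[x xS ->]; move: xS; rewrite mem_filter /f => /andP[/existsP[u0 xu0] _].
  by case: pickP => [u _|/(_ u0)]; [rewrite map_f // mem_enum | rewrite xu0].
- by rewrite size_map size_enum_ord.
Qed.

Lemma graph_progP (R : realType) p : p = 1%N \/ p = 2%N ->
  forall (n : nat) (e : rel 'I_n) (delta : R)
           (adj : 'I_n -> seq 'I_n) (S : seq (graph_point R e))
           (descr : graph_point R e -> 'I_n * 'I_n * R),
      simple_graph e ->
      connected_graph e ->
      hyperbolicity_constant (@graph_dist R n e) delta ->
      adjacency_lists e adj ->
      uniq S ->
      (forall x, x \in S -> describes (descr x) x) ->
      exists (st : state R unit) (time : nat) (c : 'I_p -> graph_point R e),
        [/\ exec (@no_step R) (graph_prog p) (graph_input adj (map descr S)) st time,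
            time%:R <= 1420%:R * ((2 * delta + 1) *
              (num_edges e + n + count (fun x => ~~ is_vertex x) S)%:R),
            graph_output st c &
            dominates (@graph_dist R n e) (range c)
              (p_radius (@graph_dist R n e) p [set` S] + delta) [set` S]].
Proof.
move=> hp n e delta adj S descr simple conn [hyp _] adjP uS descrP.
have n0 : (0 < n)%N by case: conn.
pose v0 : 'I_n := Ordinal n0.
have delta0 : 0 <= delta.
  apply: (delta_hyperbolic_ge0 _ _ _ (graph_pseudometric R n e simple conn) _ hyp _ (vertex v0)).
  exact: graph_geodesic_space.
set m := num_edges e; set k := count _ S.
have weight : (adjacency_weight n adj predT <= n + 2 * m)%N.
  rewrite /adjacency_weight (eq_bigr (fun v => 1 + #|e v|)%N) => [|v _].
    by rewrite big_split /= sum1_card card_ord leq_add2l sum_degree_le.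
  have [uA AE] := adjP v; rewrite add1n -(card_uniqP uA); congr _.+1.
  exact: eq_card.
have sizeS : (size S <= n + k)%N by apply: size_points_le.
have time_le (t : nat) :
    (t <= 5 * (12 * adjacency_weight n adj predT + 70 * size S + 2 * n + 200))%N ->
    t%:R <= 1420%:R * ((2 * delta + 1) * (m + n + k)%:R) :> R.
  move=> tl; have {}tl : (t <= 1420 * (m + n + k))%N.
    by clear -tl weight sizeS n0; lia.
  move: tl; rewrite -(ler_nat R) natrM => tl; apply: le_trans tl _.
  rewrite ler_pM2l ?ltr0n // -[leLHS]mul1r; apply: ler_wpM2r; first exact: ler0n.
  lra.
case: hp => ->.
  have [st [t [c [ex tl oc dom]]]] := graph_prog1_spec R n e simple conn
    _ erefl adj S descr adjP descrP v0 erefl delta hyp.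
  by exists st, t, c; split=> //; apply: time_le.
have [st [t [c [ex tl oc dom]]]] := graph_prog2_spec R n e simple conn
  _ erefl adj S descr adjP descrP v0 erefl delta hyp.
by exists st, t, c; split=> //; apply: time_le.
Qed.

Theorem theorem9 (R : realType) (p : nat) (hp : p = 1%N \/ p = 2%N) :
  (exists (prog : cmd geom_query) (K : nat),
    forall (X : metricType R) (delta : R) (S : set X) (x0 : X)
           (far : X -> seq X -> seq X) (geo : X -> X -> R -> X) (tX : nat),
      geodesic_space (@mdist R X) ->
      hyperbolicity_constant (@mdist R X) delta ->
      finite_set S ->
      farthest_oracle (@mdist R X) S far ->
      (forall x y, is_geodesic (@mdist R X) x y (geo x y)) ->
      (0 < tX)%N ->
      exists (st : state R X) (time : nat),
        [/\ exec (geom_step (@mdist R X) far geo tX) prog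
              (geom_input R x0) st time,
            time%:R <= K%:R * ((2 * delta + 1) * tX%:R) &
            dominates (@mdist R X) (geom_output p st)
              (p_radius (@mdist R X) p S + delta) S])
  /\
  (exists (prog : cmd void) (K : nat),
    forall (n : nat) (e : rel 'I_n) (delta : R)
           (adj : 'I_n -> seq 'I_n) (S : seq (graph_point R e))
           (descr : graph_point R e -> 'I_n * 'I_n * R),
      simple_graph e ->
      connected_graph e ->
      hyperbolicity_constant (@graph_dist R n e) delta ->
      adjacency_lists e adj ->
      uniq S ->
      (forall x, x \in S -> describes (descr x) x) ->
      exists (st : state R unit) (time : nat) (c : 'I_p -> graph_point R e),
        [/\ exec (@no_step R) prog (graph_input adj (map descr S)) st time,
            time%:R <= K%:R * ((2 * delta + 1) *
              (num_edges e + n + count (fun x => ~~ is_vertex x) S)%:R),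
            graph_output st c &
            dominates (@graph_dist R n e) (range c)
              (p_radius (@graph_dist R n e) p [set` S] + delta) [set` S]]).
Proof.
split.
  exists (geom_prog p), 9%N => X delta S x0 far geo tX geoX [hyp _] finS farP geoP tX0.
  exact: (geom_progP R X delta S x0 far geo tX geoX hyp finS farP geoP tX0 p hp).
exists (graph_prog p), 1420%N; exact: graph_progP.
Qed.
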